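(* Let $0<p\le1$ and $G_n=G(n,p)$, $n\ge1$, independent Erdős–Rényi random graphs. For $\mu>0$ let $\sigma_n^\mu$ be the chip configuration on $G_n$ in which each vertex $v$ independently receives a random number of chips with $P(\sigma^\mu_n(v)=k)=(\mu n)^k/(1+\mu n)^{k+1}$, $k\ge0$ (mean $\mu n$), all chosen independently over $n$, and coupled over $\mu$ as follows: each vertex $v$ carries an independent sequence of independent uniform $[0,1]$ random variables, and $\sigma_n^\mu(v)=k$ iff the first $k$ of them lie in $(\frac1{1+\mu n},1]$ and the $(k+1)$-th lies in $[0,\frac1{1+\mu n}]$. Then with probability one, the functions $\mu\mapsto a(G_n,\sigma_n^\mu)$ converge pointwise to a Devil's staircase on the interval $[0,\frac{p}{\log 2}]$.
   Context: For a finite graph $G$, a chip configuration is $\sigma:V(G)\to\mathbb{R}_{\ge0}$; in one parallel step each vertex $v$ fires $\lfloor\sigma(v)/\deg_G(v)\rfloor$ times (sending one chip along each incident edge per firing), and $u_n(v)$ is the number of firings of $v$ in the first $n$ steps; for connected $G$ the activity $a(G,\sigma)=\lim_n u_n(v)/n$ exists and does not depend on $v$ (almost surely $G_n$ is connected for all large $n$). $\log$ is the natural logarithm. A Devil's staircase on $[a,b]$ is a continuous nondecreasing function $c:[a,b]\to[0,1]$ with $c(a)=0$, $c(b)=1$ which is locally constant on an open dense set. *)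

(* Defs.v *)
From HB Require Import structures.
From mathcomp Require Import all_boot all_order all_algebra.
From mathcomp Require Import all_classical all_reals all_analysis.

Set Implicit Arguments.
Unset Strict Implicit.
Unset Printing Implicit Defensive.

Import Order.TTheory GRing.Theory Num.Theory.
Import numFieldNormedType.Exports.

Local Open Scope classical_set_scope.
Local Open Scope ring_scope.

Section ChipFiring.
Context {R : realType} {V : finType}.
Implicit Types (e : rel V) (sigma : V -> R) (v : V).

Definition simple_graph e : Prop := symmetric e /\ irreflexive e.

Definition degree e v : nat := #|[pred w | e v w]|.

(* [Num.truncn] is the floor on nonnegative reals; an isolated vertex never
   fires, because [x / 0 = 0]. *)
Definition firings e sigma v : nat := Num.truncn (sigma v / (degree e v)%:R).

Definition parallel_step e sigma : V -> R := fun v =>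
  sigma v - (firings e sigma v * degree e v)%N%:R
  + (\sum_(w | e v w) firings e sigma w)%N%:R.

Definition odometer e sigma (n : nat) v : nat :=
  (\sum_(t < n) firings e (iter t (parallel_step e) sigma) v)%N.

Definition is_activity e sigma (a : R) : Prop :=
  forall v, (odometer e sigma n v)%:R / n%:R @[n --> \oo] --> a.

(* The junk value -1, used when the vertices have no common limit (which can
   only happen on a disconnected graph), is not an activity: if [V] is nonempty,
   activities are nonnegative.  Hence a sequence [activity (e n) (sigma n)] with a
   nonnegative limit is made of actual activities from some rank on. *)
Definition activity e sigma : R := xget (-1) (is_activity e sigma).

End ChipFiring.

(* [c] is only meaningful on [a, b].  The relatively open subsets of [a, b] are
   the sets [D `&` `[a, b]] with [D] open in [R]. *)
Definition devils_staircase {R : realType} (a b : R) (c : R -> R) : Prop :=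
  [/\ {within `[a, b], continuous c},
      {in `[a, b] &, {homo c : x y / x <= y}},
      {in `[a, b], forall x, 0 <= c x <= 1},
      c a = 0 /\ c b = 1 &
      exists D : set R,
        [/\ open D,
            `[a, b] `<=` closure (D `&` `[a, b]) &
            forall x, (D `&` `[a, b]) x ->
              \forall y \near x, y \in `[a, b] -> c y = c x]].

Section Randomness.
Context {R : realType} {d : measure_display} {Omega : measurableType d}
  (P : probability Omega R).

Definition mutually_independent (I : eqType) (F : I -> set (set Omega)) : Prop :=
  forall (s : seq I) (A : I -> set Omega), uniq s ->
    (forall i, i \in s -> F i (A i)) ->
    P (\bigcap_(i in [set` s]) A i) = (\prod_(i <- s) P (A i))%E.

(* G(n, p): the edges ij with i < j are independent events of probability p. *)
Definition erdos_renyi (n : nat) (p : R) (G : Omega -> rel 'I_n) : Prop :=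
  [/\ forall w, simple_graph (G w),
      forall i j : 'I_n, (i < j)%N ->
        measurable [set w | G w i j] /\ P [set w | G w i j] = p%:E &
      mutually_independent
        (fun ij : {ij : 'I_n * 'I_n | (ij.1 < ij.2)%N} =>
           [set [set w | G w (val ij).1 (val ij).2]])].

Definition uniform01 (X : {RV P >-> R}) : Prop :=
  forall B, measurable B ->
    distribution P X B = uniform_prob (@ltr01 R) B.

(* The sources of randomness are the graphs [G n], indexed by [inl n], and the
   variables [U n v k], indexed by [inr (n, v, k)]; each one contributes the
   events it generates. *)
Definition source_events (G : forall n, Omega -> rel 'I_n)
    (U : forall n, 'I_n -> nat -> {RV P >-> R})
    (i : nat + {n : nat & ('I_n * nat)%type}) : set (set Omega) :=
  match i with
  | inl n => [set [set w | Q (G n w)] | Q in [set: set (rel 'I_n)]]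
  | inr (existT n (v, k)) =>
      [set U n v k @^-1` B | B in [set B : set R | measurable B]]
  end.

End Randomness.

Section Configuration.
Context {R : realType}.

(* [u] is the sequence of uniform variables carried by a vertex.  The default
   value 0 is used only when no such [k] exists, which has probability 0 if [u]
   is a sequence of independent uniform variables. *)
Definition geometric_chips (n : nat) (mu : R) (u : nat -> R) : nat :=
  let t := (1 + mu * n%:R)^-1 in
  xget 0%N [set k : nat | (forall i, (i < k)%N -> u i \in `]t, 1]) /\
                          u k \in `[0, t]].

Definition chip_configuration (n : nat) (mu : R) (u : 'I_n -> nat -> R) :
    'I_n -> R :=
  fun v => (geometric_chips n mu (u v))%:R.

End Configuration.

(* Main.v *)
Require Import Defs.
From HB Require Import structures.
From mathcomp Require Import all_boot all_order all_algebra.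
From mathcomp Require Import all_classical all_reals all_analysis.
From mathcomp Require Import lra.
Import Order.TTheory GRing.Theory Num.Theory.
Import numFieldNormedType.Exports.
Local Open Scope classical_set_scope.
Local Open Scope ring_scope.

(** The concentration bounds are applied at a fixed parameter and at finitely many values of [r],
    whereas the conclusion concerns all real [mu] at once and the comparison needs all [r] in [[0,
    1[]. The strict inequality between [b'] and [b] is the room that pays for this: it absorbs the
    fluctuation of the degrees, the replacement of [r] by a grid point, the rounding of chip
    thresholds to integers and, for lower bounds, the truncation to finitely many firings. The
    exceptional null set is made independent of [mu] by using rational parameters only; the coupling
    makes the activity monotone in [mu], and continuity of the rotation number closes the gap. The
    other obstacle is that [activity] has a default value, so the limit must be shown to exist.
    Instead of connectivity the proof uses that any two vertices have a common neighbour, which also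
    follows from concentration. Together with conservation of chips this bounds the oscillation of
    the odometer over the vertices, uniformly in time, and so makes it quasi-additive. *)

(** The odometer satisfies [u_(t+1)(v) = floor (sigma v / deg v + r_t(v))], where
    [r_t(v)] is the average of [u_t] over the neighbours of [v].  If, for every [v]
    and [r], the average of [floor (sigma w / deg w + r)] over the neighbours [w] of
    [v] is at most [F r], with [F] nondecreasing and [F (r + 1) = F r + 1], then
    [r_t(v) <= F^t(0)] for all [v] by monotonicity, and the activity is at most the
    rotation number of [F]; likewise for lower bounds.  On [G(n, p)] the law of
    [sigma w / deg w] is close to the exponential law of rate [b = p / mu], for
    which this average is [expo_map b r], that is [e^(b r) / (e^b - 1)] on [[0, 1]].
    Exponential concentration (Chernoff) and Borel-Cantelli make the bounds hold,
    for all vertices at once, with [F = expo_map b'] for any [b'] on the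
    appropriate side of [b].

    Hence the limit is [mu |-> rotation number of expo_map (p / mu)], which is
    continuous and monotone.  If it took a rational value [k / q] at a single
    parameter, the [q]-th iterate of the map would be the translation by [k]; this
    is impossible, because the map is strictly convex between its break points,
    which are the integers.  So it is locally constant on a dense open set.  At
    [b = ln 2] the map sends 0 to 1, so that the rotation number is 1. *)

Set Implicit Arguments.
Unset Strict Implicit.
Unset Printing Implicit Defensive.

(** * Rotation numbers *)

Section QuasiAdditive.
Context {R : realType}.

(** The Archimedean property, in the form used to compare slopes: two sequences that stay within
    bounded distance of linear ones can be compared without passing to the limit. *)
Lemma le0_natmul_bounded (a b : R) : (forall j : nat, j%:R * a <= b) -> a <= 0.
Proof.
move=> H; rewrite leNgt; apply/negP => a0.
have := H (Num.truncn (b / a)).+1.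
rewrite leNgt => /negP; apply.
by rewrite -ltr_pdivrMr// truncnS_gt.
Qed.

Lemma quasi_additive_multiple (x : nat -> R) C :
  (forall s t, `|x (s + t)%N - x s - x t| <= C) ->
  forall t k, `|x (k * t)%N - k%:R * x t| <= k.+1%:R * C.
Proof.
move=> H t; elim=> [|k IH].
  by have := H 0 0; rewrite add0n mul0n mul0r subr0 subrr sub0r normrN mul1r.
rewrite mulSn.
have -> : x (t + k * t)%N - k.+1%:R * x t =
  (x (t + k * t)%N - x t - x (k * t)%N) + (x (k * t)%N - k%:R * x t).
  by rewrite -natr1; lra.
rewrite (le_trans (ler_normD _ _))//.
rewrite -[in leRHS]natr1 mulrDl mul1r addrC.
exact: lerD.
Qed.

(** Comparing [x (j * s * t)] with multiples of [x s] and of [x t], and letting [j] grow, shows that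
    every [(x t - C) / t] lies below every [(x s + C) / s]. Any number separating the two families
    is a slope with error exactly [C]; the supremum of the lower family is one. *)
Lemma quasi_additive_slope (x : nat -> R) C :
  (forall s t, `|x (s + t)%N - x s - x t| <= C) ->
  exists l, forall t, `|x t - t%:R * l| <= C.
Proof.
move=> H.
have C0 : 0 <= C by exact: le_trans (normr_ge0 _) (H 0 0).
have cmp s t : (0 < s)%N -> (0 < t)%N -> (x t - C) / t%:R <= (x s + C) / s%:R.
  move=> s0 t0.
  rewrite ler_pdivrMr ?ltr0n// mulrAC ler_pdivlMr ?ltr0n//.
  rewrite -subr_le0; apply: (@le0_natmul_bounded _ (2 * C)) => j.
  have /ler_normlP[_ h1] := quasi_additive_multiple H s (j * t)%N.
  have /ler_normlP[h2 _] := quasi_additive_multiple H t (j * s)%N.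
  have e : (j * t * s = j * s * t)%N by rewrite -!mulnA (mulnC t).
  move: h1 h2; rewrite e -![_.+1%:R]natr1 !natrM => h1 h2.
  lra.
pose A := [set (x t - C) / t%:R | t in [set t | (0 < t)%N]].
have hA : has_sup A.
  split; first by exists ((x 1%N - C) / 1%:R); exists 1%N.
  by exists ((x 1%N + C) / 1%:R) => _ [t t0 <-]; exact: cmp.
exists (sup A) => -[|t].
  by have := H 0 0; rewrite add0n mul0r subr0 subrr sub0r normrN.
have t0 : (0 : R) < t.+1%:R by rewrite ltr0n.
rewrite ler_norml; apply/andP; split.
  have : sup A <= (x t.+1 + C) / t.+1%:R.
    by apply: ge_sup => [|_ [s s0 <-]]; [case: hA|exact: cmp].
  by rewrite ler_pdivlMr//; lra.
have : (x t.+1 - C) / t.+1%:R <= sup A by apply: sup_upper_bound => //; exists t.+1.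
by rewrite ler_pdivrMr//; lra.
Qed.

Lemma bounded_deviation_cvg (x : nat -> R) l C :
  (forall t, `|x t - t%:R * l| <= C) -> x t / t%:R @[t --> \oo] --> l.
Proof.
move=> H; apply/cvgrPdist_le => e e0.
have C0 : 0 <= C by exact: le_trans (normr_ge0 _) (H 0).
near=> t.
have t0 : (0 : R) < t%:R by near: t; exact: nbhs_infty_gtr.
have -> : l - x t / t%:R = - ((x t - t%:R * l) / t%:R).
  by rewrite mulrBl mulrAC divff ?gt_eqF// mul1r opprB.
rewrite normrN normrM normfV (ger0_norm (ltW t0)) ler_pdivrMr//.
rewrite (le_trans (H t))// -ler_pdivrMl//.
by near: t; exact: nbhs_infty_ger.
Unshelve. all: by end_near.
Qed.

End QuasiAdditive.

Section RotationNumber.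
Context {R : realType}.
Implicit Types F G : R -> R.

(** A monotone lift of degree one, kept on the nonnegative half-line because [Num.truncn] is the
    floor only there. *)
Definition circle_lift F := [/\ 0 <= F 0,
  forall x y, 0 <= x -> x <= y -> F x <= F y &
  forall x, 0 <= x -> F (x + 1) = F x + 1].

Definition rotation_number F : R := lim (iter t F 0 / t%:R @[t --> \oo]).

Lemma circle_lift_ge0 F x : circle_lift F -> 0 <= x -> 0 <= F x.
Proof. by case=> F0 Fm _ x0; exact: le_trans F0 (Fm _ _ _ x0). Qed.

Lemma iter_lift_ge0 F x t : circle_lift F -> 0 <= x -> 0 <= iter t F x.
Proof. by move=> hF x0; elim: t => //= t; exact: circle_lift_ge0. Qed.

Lemma iter_lift_homo F x y t : circle_lift F -> 0 <= x -> x <= y ->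
  iter t F x <= iter t F y.
Proof.
move=> hF x0 xy; elim: t => //= t IH; case: (hF) => _ + _; apply=> //.
exact: iter_lift_ge0.
Qed.

Lemma lift_natr F x k : circle_lift F -> 0 <= x -> F (x + k%:R) = F x + k%:R.
Proof.
move=> hF x0; elim: k => [|k IH]; first by rewrite !addr0.
by rewrite -natr1 !addrA -IH; case: hF => _ _ ->//; exact: addr_ge0.
Qed.

Lemma iter_lift_natr F x t k : circle_lift F -> 0 <= x ->
  iter t F (x + k%:R) = iter t F x + k%:R.
Proof.
by move=> hF x0; elim: t => //= t ->; rewrite lift_natr//; exact: iter_lift_ge0.
Qed.

Lemma iter_lift_le F G x t : circle_lift F -> circle_lift G ->
  (forall x, 0 <= x -> F x <= G x) -> 0 <= x -> iter t F x <= iter t G x.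
Proof.
move=> hF hG FG x0; elim: t => //= t IH.
have h := iter_lift_ge0 t hF x0.
by apply: le_trans (FG _ h) _; case: hG => _ + _; apply.
Qed.

(** If [y = F^s(0)] lies between [n] and [n + 1], then [F^t(y)] lies between [F^t(0) + n] and
    [F^t(0) + n + 1], because iterates are monotone and commute with integer translations. *)
Lemma iter_lift_quasi_additive F s t : circle_lift F ->
  `|iter (s + t) F 0 - iter s F 0 - iter t F 0| <= 1.
Proof.
move=> hF; rewrite addnC iterD; set y := iter s F 0.
have y0 : 0 <= y by exact: iter_lift_ge0.
have /andP[h1 h2] := truncn_itv y0.
have := iter_lift_homo t hF (ler0n _ _) h1.
have := iter_lift_homo t hF y0 (ltW h2).
rewrite -[(Num.truncn y).+1%:R]add0r -[(Num.truncn y)%:R]add0r !iter_lift_natr// => h3 h4.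
by rewrite ler_norml; move: h2 h3; rewrite -natr1; lra.
Qed.

Lemma rotation_number_cvg F : circle_lift F ->
  iter t F 0 / t%:R @[t --> \oo] --> rotation_number F /\
  forall t, `|iter t F 0 - t%:R * rotation_number F| <= 1.
Proof.
move=> hF.
have [l hl] := quasi_additive_slope (fun s t => iter_lift_quasi_additive s t hF).
have cl := bounded_deviation_cvg hl.
by rewrite /rotation_number (cvg_lim _ cl).
Qed.

Lemma rotation_number_le F G : circle_lift F -> circle_lift G ->
  (forall x, 0 <= x -> F x <= G x) -> rotation_number F <= rotation_number G.
Proof.
move=> hF hG FG; rewrite -subr_le0; apply: (@le0_natmul_bounded _ _ 2) => j.
have [_ /(_ j)/ler_normlP[h1 _]] := rotation_number_cvg hF.
have [_ /(_ j)/ler_normlP[_ h2]] := rotation_number_cvg hG.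
have := iter_lift_le j hF hG FG (lexx 0).
lra.
Qed.

Lemma iter_mul_ge F x q k j : circle_lift F -> 0 <= x ->
  x + k%:R <= iter q F x -> x + (j * k)%:R <= iter (j * q) F x.
Proof.
move=> hF x0 h; elim: j => [|j IH]; first by rewrite addr0.
rewrite !mulSn natrD iterD.
have := iter_lift_homo q hF (addr_ge0 x0 (ler0n _ (j * k))) IH.
by rewrite iter_lift_natr//; lra.
Qed.

Lemma iter_mul_le F x q k j : circle_lift F -> 0 <= x ->
  iter q F x <= x + k%:R -> iter (j * q) F x <= x + (j * k)%:R.
Proof.
move=> hF x0 h; elim: j => [|j IH]; first by rewrite addr0.
rewrite !mulSn natrD iterD.
have := iter_lift_homo q hF (iter_lift_ge0 _ hF x0) IH.
by rewrite iter_lift_natr//; lra.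
Qed.

(** The inequality reproduces itself [j] times along the orbit of [x]; replacing that orbit by the
    orbit of 0 costs at most the integer [K] above [x], whatever [j] is. *)
Lemma rotation_number_ge_ratio F x q k : circle_lift F -> 0 <= x -> (0 < q)%N ->
  x + k%:R <= iter q F x -> k%:R / q%:R <= rotation_number F.
Proof.
move=> hF x0 q0 h.
rewrite ler_pdivrMr ?ltr0n// -subr_le0.
set K := (Num.truncn x).+1%:R : R.
apply: (@le0_natmul_bounded _ _ (1 + K)) => j.
have := iter_mul_ge j hF x0 h.
have xK : x <= K by rewrite ltW// truncnS_gt.
have := iter_lift_homo (j * q) hF x0 xK.
rewrite -[K]add0r iter_lift_natr//.
have [_ /(_ (j * q)%N)/ler_normlP[_]] := rotation_number_cvg hF.
by rewrite -/K !natrM; lra.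
Qed.

Lemma rotation_number_le_ratio F x q k : circle_lift F -> 0 <= x -> (0 < q)%N ->
  iter q F x <= x + k%:R -> rotation_number F <= k%:R / q%:R.
Proof.
move=> hF x0 q0 h.
rewrite ler_pdivlMr ?ltr0n// -subr_le0.
apply: (@le0_natmul_bounded _ _ (1 + x)) => j.
have := iter_mul_le j hF x0 h.
have := iter_lift_homo (j * q) hF (lexx 0) x0.
have [_ /(_ (j * q)%N)/ler_normlP[+ _]] := rotation_number_cvg hF.
by rewrite !natrM; lra.
Qed.

End RotationNumber.

(** * The exponential family of circle maps *)

Section ExponentialCircleMap.
Context {R : realType}.
Implicit Types b x y : R.

(** The sum over [a >= 1] of [e^(-b (a - y))]. For [0 <= y <= 1] this is the sum of the tail
    probabilities [P(T + y >= a)], hence the mean of the floor of [T + y], for [T] exponential of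
    rate [b]. *)
Definition expo_branch b y : R := expR (b * y) / (expR b - 1).

Definition expo_map b x : R :=
  (Num.truncn x)%:R + expo_branch b (x - (Num.truncn x)%:R).

Lemma expRB1_gt0 b : 0 < b -> 0 < expR b - 1.
Proof. by move=> b0; rewrite subr_gt0 expR_gt1. Qed.

Lemma expo_branch_gt0 b y : 0 < b -> 0 < expo_branch b y.
Proof. by move=> b0; rewrite divr_gt0 ?expR_gt0 ?expRB1_gt0. Qed.

Lemma expo_branch_lt b y z : 0 < b -> y < z -> expo_branch b y < expo_branch b z.
Proof. by move=> b0 yz; rewrite ltr_pM2r ?invr_gt0 ?expRB1_gt0// ltr_expR ltr_pM2l. Qed.

Lemma expo_branch_le b y z : 0 < b -> y <= z -> expo_branch b y <= expo_branch b z.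
Proof. by move=> b0; rewrite le_eqVlt => /predU1P[->//|/(expo_branch_lt b0)/ltW]. Qed.

Lemma expo_branch1 b : 0 < b -> expo_branch b 1 = expo_branch b 0 + 1.
Proof.
move=> /expRB1_gt0 b0; rewrite /expo_branch mulr0 expR0 mulr1.
by rewrite -[X in _ = _ + X](@divff _ (expR b - 1)) ?gt_eqF// -mulrDl subrKC.
Qed.

(* In this form the denominator is visibly increasing in [b]. *)
Lemma expo_branchE b y :
  expo_branch b y = (expR (b * (1 - y)) - expR (- (b * y)))^-1.
Proof.
rewrite /expo_branch -[expR (b * y)]invrK -expRN -invfM; congr (_^-1).
by rewrite mulrBr mulr1 -expRD mulrBr mulr1 (addrC (- _)).
Qed.

Lemma expo_branch_antitone b b' y : 0 < b -> b <= b' -> 0 <= y <= 1 ->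
  expo_branch b' y <= expo_branch b y.
Proof.
move=> b0 bb' /andP[y0 y1].
have b'0 : 0 < b' by exact: lt_le_trans bb'.
have := expo_branch_gt0 y b0; have := expo_branch_gt0 y b'0.
rewrite !expo_branchE !invr_gt0 => d' d; rewrite lef_pV2 ?posrE//.
apply: lerB; rewrite ler_expR.
  by rewrite ler_wpM2r// subr_ge0.
by rewrite lerN2 ler_wpM2r.
Qed.

(** The right endpoint is allowed because consecutive branches agree there, by [expo_branch1]. *)
Lemma expo_mapE b x n : 0 < b -> n%:R <= x <= n.+1%:R ->
  expo_map b x = n%:R + expo_branch b (x - n%:R).
Proof.
move=> b0 /andP[nx]; rewrite le_eqVlt => /predU1P[->|xn].
  rewrite /expo_map natrK subrr -natr1 (addrC _ 1) addrK expo_branch1//.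
  lra.
by rewrite /expo_map (@truncn_def _ x n)// nx.
Qed.

Lemma expo_map_branch b y : 0 < b -> 0 <= y <= 1 -> expo_map b y = expo_branch b y.
Proof. by move=> b0 y01; rewrite (@expo_mapE _ _ 0)// ?subr0 ?add0r. Qed.

Lemma expo_map_lt b x y : 0 < b -> 0 <= x -> x < y -> expo_map b x < expo_map b y.
Proof.
move=> b0 x0 xy; have y0 : 0 <= y by exact: le_trans x0 (ltW xy).
have /andP[hx1 hx2] := truncn_itv x0; have /andP[hy1 hy2] := truncn_itv y0.
rewrite /expo_map.
have := le_truncn (ltW xy); rewrite leq_eqVlt => /predU1P[->|lt].
  by rewrite ltrD2l expo_branch_lt// ltrD2r.
have h1 : expo_branch b (x - (Num.truncn x)%:R) < expo_branch b 0 + 1.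
  by rewrite -expo_branch1// expo_branch_lt// ltrBlDr nat1r.
have h2 : expo_branch b 0 <= expo_branch b (y - (Num.truncn y)%:R).
  by rewrite expo_branch_le// subr_ge0.
have : (Num.truncn x).+1%:R <= (Num.truncn y)%:R :> R by rewrite ler_nat.
by rewrite -natr1; lra.
Qed.

Lemma expo_map_le b x y : 0 < b -> 0 <= x -> x <= y -> expo_map b x <= expo_map b y.
Proof. by move=> b0 x0; rewrite le_eqVlt => /predU1P[->//|/(expo_map_lt b0 x0)/ltW]. Qed.

Lemma expo_map_lift b : 0 < b -> circle_lift (expo_map b).
Proof.
move=> b0; split=> [|x y|x x0].
- by rewrite expo_map_branch ?lexx ?ler01// ltW// expo_branch_gt0.
- exact: expo_map_le.
- have /andP[h1 h2] := truncn_itv x0.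
  rewrite (@expo_mapE _ (x + 1) (Num.truncn x).+1)//; last first.
    by move: h1 h2; rewrite -!natr1; lra.
  rewrite /expo_map -natr1 opprD addrACA subrr addr0; lra.
Qed.

Lemma expo_map_antitone b b' x : 0 < b -> b <= b' -> 0 <= x ->
  expo_map b' x <= expo_map b x.
Proof.
move=> b0 bb' x0; rewrite lerD2l expo_branch_antitone//.
by have /andP[] := truncn_itv x0; rewrite -natr1; lra.
Qed.

(** The derivative of [expo_branch b] at 1, which is its largest slope on [[0, 1]]. *)
Definition expo_lip b : R := b * expR b / (expR b - 1).

Lemma expo_branch_lipschitz b y z : 0 < b -> y <= z -> z <= 1 ->
  expo_branch b z - expo_branch b y <= expo_lip b * (z - y).
Proof.
move=> b0 yz z1; rewrite /expo_branch -mulrBl /expo_lip mulrAC.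
rewrite ler_pM2r ?invr_gt0 ?expRB1_gt0//.
have -> : b * y = b * z + - (b * (z - y)) by lra.
rewrite expRD.
have h1 : 1 - b * (z - y) <= expR (- (b * (z - y))) by exact: expR_ge1Dx.
have h2 : expR (b * z) <= expR b by rewrite ler_expR ger_pMr.
have h3 : 0 < expR (b * z) by exact: expR_gt0.
have h4 : 0 <= b * (z - y) by rewrite mulr_ge0 ?subr_ge0// ltW.
have := ler_wpM2r h4 h2; have := ler_wpM2l (ltW h3) h1.
lra.
Qed.

Lemma expo_map_lipschitz b x y : 0 < b -> 0 <= x -> x <= y ->
  expo_map b y - expo_map b x <= expo_lip b * (y - x).
Proof.
move=> b0 x0 xy; have y0 : 0 <= y by exact: le_trans x0 xy.
have /andP[hx1 hx2] := truncn_itv x0; have /andP[hy1 hy2] := truncn_itv y0.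
rewrite /expo_map.
have := le_truncn xy; rewrite leq_eqVlt => /predU1P[e|lt].
  have := @expo_branch_lipschitz b (x - (Num.truncn x)%:R) (y - (Num.truncn y)%:R) b0.
  by rewrite e; move: hy2; rewrite -natr1; lra.
have l1 : (Num.truncn x).+1%:R <= (Num.truncn y)%:R :> R by rewrite ler_nat.
have b1 := expo_branch1 b0.
move: hy2 hx2 l1; rewrite -!natr1 => hy2 hx2 l1.
have := @expo_branch_lipschitz b (x - (Num.truncn x)%:R) 1 b0.
have := @expo_branch_lipschitz b 0 (y - (Num.truncn y)%:R) b0.
have := @expo_branch_lipschitz b 0 1 b0 ler01 (lexx _).
rewrite subr0 mulr1 => L1 h1 h2.
have {}h1 := h1 ltac:(lra) ltac:(lra).
have {}h2 := h2 ltac:(lra) ltac:(lra).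
(* A whole branch rises by 1 over a length of 1, so the constant is at least 1 and also covers the
   full periods between [x] and [y]. *)
have L1' : 1 <= expo_lip b by lra.
have l2 : 0 <= (Num.truncn y)%:R - (Num.truncn x)%:R - 1 :> R by lra.
have := ler_wpM2r l2 L1'.
lra.
Qed.

(** The constant depends only on the lower bound [a], not on [x]: when maps are iterated, the point
    of evaluation moves with the parameter. *)
Lemma expo_map_param a b b' x : 0 < a -> a <= b -> a <= b' -> 0 <= x ->
  `|expo_map b' x - expo_map b x| <=
  expR a / (expR a - 1) / (expR a - 1) * `|expR b' - expR b|.
Proof.
move=> a0; wlog bb' : b b' / b <= b'.
  move=> H ab ab' x0; have [bb'|bb'] := leP b b'; first exact: H.
  by rewrite distrC (distrC (expR _)); apply: H => //; exact: ltW.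
move=> ab ab' x0.
have b0 : 0 < b by exact: lt_le_trans ab.
have b'0 : 0 < b' by exact: lt_le_trans ab'.
rewrite distrC !ger0_norm ?subr_ge0 ?ler_expR//; last exact: expo_map_antitone.
rewrite /expo_map opprD addrACA subrr add0r.
set y := x - _.
have /andP[y0 y1] : 0 <= y <= 1.
  by have /andP[] := truncn_itv x0; rewrite /y -natr1; lra.
have e0 := expRB1_gt0 a0; have e1 := expRB1_gt0 b0; have e2 := expRB1_gt0 b'0.
have -> : expo_branch b y - expo_branch b' y =
  (expo_branch b y * (expR b' - 1) - expR (b' * y)) / (expR b' - 1).
  by rewrite mulrBl mulfK ?gt_eqF.
rewrite ler_pdivrMr//.
have -> : expo_branch b y * (expR b' - 1) =
   expo_branch b y * (expR b' - expR b) + expR (b * y).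
  rewrite -[X in _ = _ + X](@divfK _ (expR b - 1)) ?gt_eqF// -/(expo_branch b y).
  by rewrite -mulrDr addrA subrK.
have h1 : expR (b * y) <= expR (b' * y) by rewrite ler_expR ler_wpM2r.
have h2 : expo_branch b y <= expo_branch a 1.
  apply: le_trans (expo_branch_le b0 y1) _.
  by apply: expo_branch_antitone => //; rewrite ler01 lexx.
have h3 : expo_branch a 1 = expR a / (expR a - 1) by rewrite /expo_branch mulr1.
have h4 : 0 <= expR b' - expR b by rewrite subr_ge0 ler_expR.
have h5 : 1 <= (expR b' - 1) / (expR a - 1).
  by rewrite ler_pdivlMr// mul1r lerB// ler_expR.
rewrite -h3.
set A := expo_branch a 1 in h2 *; set B := expR b' - expR b in h4 *.
have A0 : 0 < A by exact: expo_branch_gt0.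
have -> : A / (expR a - 1) * B * (expR b' - 1) =
  A * B * ((expR b' - 1) / (expR a - 1)).
  by rewrite !mulrA; lra.
have := ler_wpM2l (mulr_ge0 (ltW A0) h4) h5.
have := ler_wpM2r h4 h2.
lra.
Qed.

Lemma expo_map_iter_cvg b x t : 0 < b -> 0 <= x ->
  iter t (expo_map b') x @[b' --> b] --> iter t (expo_map b) x.
Proof.
move=> b0 x0; elim: t => [|t IH] /=; first exact: cvg_cst.
(* The constant of [expo_map_param] blows up at 0, so the nearby parameters are kept above [b / 2].
   The error splits into a change of map at the point [v] and a change of point for the map at
   [b]. *)
set a := b / 2; have a0 : 0 < a by rewrite divr_gt0.
have hb := expo_map_lift b0.
apply/cvgrPdist_le => e e0.
set K := expR a / (expR a - 1) / (expR a - 1).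
have K0 : 0 < K by rewrite !divr_gt0 ?expR_gt0 ?expRB1_gt0.
have L0 : 0 < expo_lip b by rewrite divr_gt0 ?mulr_gt0 ?expR_gt0 ?expRB1_gt0.
have eK : 0 < e / 2 / K by rewrite divr_gt0// divr_gt0.
have eL : 0 < e / 2 / expo_lip b by rewrite divr_gt0// divr_gt0.
have cexp : expR b' @[b' --> b] --> expR b by exact: continuous_expR.
move/cvgrPdist_le/(_ _ eK) : cexp => cexp.
move/cvgrPdist_le/(_ _ eL) : IH => IH.
near=> b'.
have ab' : a < b'.
  near: b'; apply: lt_nbhsr; rewrite /a ltr_pdivrMr// mulr2n mulrDr mulr1; lra.
have ab : a <= b by rewrite /a ler_pdivrMr// mulr2n mulrDr mulr1; lra.
have b'0 : 0 < b' by exact: lt_trans ab'.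
set u := iter t (expo_map b) x; set v := iter t (expo_map b') x.
have u0 : 0 <= u by exact: iter_lift_ge0.
have v0 : 0 <= v by apply: iter_lift_ge0 => //; exact: expo_map_lift.
have h1 : `|expo_map b v - expo_map b' v| <= e / 2.
  rewrite distrC; apply: le_trans (expo_map_param a0 ab (ltW ab') v0) _.
  rewrite -/K -ler_pdivlMl// distrC mulrC.
  by near: b'.
have h2 : `|expo_map b u - expo_map b v| <= e / 2.
  apply: (@le_trans _ _ (expo_lip b * `|u - v|)).
    have [uv|vu] := leP u v.
      rewrite distrC (distrC u) !ger0_norm ?subr_ge0 ?expo_map_le//.
      exact: expo_map_lipschitz.
    have {}vu := ltW vu.
    rewrite !ger0_norm ?subr_ge0 ?expo_map_le//.
    exact: expo_map_lipschitz.
  rewrite -ler_pdivlMl// mulrC /u /v.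
  by near: b'.
by apply: le_trans (ler_distD (expo_map b v) _ _) _; rewrite [e]splitr; exact: lerD.
Unshelve. all: by end_near.
Qed.

Definition expo_rotation b : R := rotation_number (expo_map b).

Lemma expo_rotation_antitone b b' : 0 < b -> b <= b' ->
  expo_rotation b' <= expo_rotation b.
Proof.
move=> b0 bb'; apply: rotation_number_le.
- by apply: expo_map_lift; exact: lt_le_trans bb'.
- exact: expo_map_lift.
- by move=> x; exact: expo_map_antitone.
Qed.

Lemma expo_rotation_ge0 b : 0 < b -> 0 <= expo_rotation b.
Proof.
move=> b0; rewrite -[X in X <= _](mul0r 1%:R^-1).
apply: (@rotation_number_ge_ratio R _ 0 1 0 (expo_map_lift b0)) => //.
by rewrite addr0; case: (expo_map_lift b0).
Qed.

Lemma slope_dist (t e x y u v : R) : 0 < t -> 3 <= t * e ->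
  `|u - t * x| <= 1 -> `|v - t * y| <= 1 -> `|u - v| <= 1 -> `|x - y| <= e.
Proof.
move=> t0 te; rewrite -[`|x - y| <= e](ler_pM2l t0).
have -> : t * `|x - y| = `|t * (x - y)| by rewrite normrM (ger0_norm (ltW t0)).
by rewrite mulrBr !ler_norml; lra.
Qed.

(* The iterates divided by [t] converge to the rotation number with an error of
   [1 / t], uniformly in the parameter. *)
Lemma expo_rotation_continuous b : 0 < b ->
  expo_rotation b' @[b' --> b] --> expo_rotation b.
Proof.
move=> b0; apply/cvgrPdist_le => e e0.
pose t := (Num.truncn (3 / e)).+1.
have t0 : (0 : R) < t%:R by rewrite ltr0n.
have te : 3 <= t%:R * e by rewrite -ler_pdivrMr// ltW// truncnS_gt.
have /cvgrPdist_le/(_ _ ltr01) c := @expo_map_iter_cvg b 0 t b0 (lexx 0).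
near=> b'.
have b'0 : 0 < b' by near: b'; exact: lt_nbhsr.
have [_ /(_ t) h1] := rotation_number_cvg (expo_map_lift b0).
have [_ /(_ t) h2] := rotation_number_cvg (expo_map_lift b'0).
have h3 : `|iter t (expo_map b) 0 - iter t (expo_map b') 0| <= 1 by near: b'.
exact: slope_dist t0 te h1 h2 h3.
Unshelve. all: by end_near.
Qed.

(** For such [b] the point [1 / 2] is not moved to the right, since [s = e^(b / 2) >= 3] satisfies
    [2 s <= s^2 - 1]. This makes the limit vanish for small [mu], hence continuous at 0. *)
Lemma expo_rotation_eq0 b : 4 <= b -> expo_rotation b = 0.
Proof.
move=> b4; have b0 : 0 < b by lra.
apply/eqP; rewrite eq_le expo_rotation_ge0// andbT.
have h : 0 <= 1 / 2 :> R by lra.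
rewrite -[X in _ <= X](mul0r 1%:R^-1).
apply: (@rotation_number_le_ratio R _ _ 1 0 (expo_map_lift b0) h) => //.
rewrite addr0 /= expo_map_branch//; last by apply/andP; split; lra.
rewrite /expo_branch ler_pdivrMr ?expRB1_gt0//.
have -> : expR b = expR (b * (1 / 2)) ^+ 2 by rewrite -expRM_natl; congr expR; lra.
have := expR_ge1Dx (b * (1 / 2)).
set s := expR _ => hs.
have s3 : 3 <= s by lra.
have : 0 <= (s - 3) * (s + 1) by rewrite mulr_ge0; lra.
rewrite expr2; lra.
Qed.

Lemma expo_rotation_ln2 : expo_rotation (ln 2) = 1.
Proof.
have b0 : 0 < ln 2 :> R by rewrite ln_gt0// ltr1n.
have e : iter 1 (expo_map (ln 2)) 0 = 0 + 1%:R :> R.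
  rewrite /= expo_map_branch ?lexx ?ler01// /expo_branch mulr0 expR0.
  by rewrite lnK ?posrE// add0r (_ : 2 - 1 = 1) ?divr1//; lra.
apply/eqP; rewrite eq_le; apply/andP; split.
  have := @rotation_number_le_ratio R (expo_map (ln 2)) 0 1 1.
  by rewrite divr1; apply => //; [exact: expo_map_lift|rewrite e].
have := @rotation_number_ge_ratio R (expo_map (ln 2)) 0 1 1.
by rewrite divr1; apply => //; [exact: expo_map_lift|rewrite e].
Qed.

(** Strict convexity on one branch reduces to [2 u v < u^2 + v^2] for the exponentials at half the
    exponents. The midpoint form composes along iterates using monotonicity alone. *)
Lemma expo_map_midpoint b x y n : 0 < b -> n%:R <= x -> x < y -> y <= n.+1%:R ->
  expo_map b ((x + y) / 2) < (expo_map b x + expo_map b y) / 2.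
Proof.
move=> b0 nx xy yn.
rewrite !(@expo_mapE _ _ n)//; try by apply/andP; split; lra.
suff : expo_branch b ((x + y) / 2 - n%:R) <
  (expo_branch b (x - n%:R) + expo_branch b (y - n%:R)) / 2 by lra.
rewrite /expo_branch -mulrDl mulrAC ltr_pM2r ?invr_gt0 ?expRB1_gt0//.
set u := expR (b * (x - n%:R) / 2); set v := expR (b * (y - n%:R) / 2).
have -> : expR (b * ((x + y) / 2 - n%:R)) = u * v.
  by rewrite -expRD; congr expR; lra.
have -> : expR (b * (x - n%:R)) = u * u by rewrite -expRD; congr expR; lra.
have -> : expR (b * (y - n%:R)) = v * v by rewrite -expRD; congr expR; lra.
have uv : u < v by rewrite ltr_expR ltr_pM2r// ltr_pM2l// ltrD2r.
have : 0 < (v - u) * (v - u) by rewrite mulr_gt0 ?subr_gt0.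
lra.
Qed.

Lemma expo_map_iter_lipschitz b x t : 0 < b -> 0 <= x ->
  iter t (expo_map b) x <= iter t (expo_map b) 0 + expo_lip b ^+ t * x.
Proof.
move=> b0 x0; elim: t => [|t IH] /=; first by rewrite expr0 mul1r add0r.
have hb := expo_map_lift b0.
have h0 := iter_lift_ge0 t hb (lexx 0).
have := expo_map_lipschitz b0 h0 (iter_lift_homo t hb (lexx 0) x0).
have L0 : 0 < expo_lip b by rewrite divr_gt0 ?mulr_gt0 ?expR_gt0 ?expRB1_gt0.
rewrite exprS -mulrA.
have : expo_lip b * (iter t (expo_map b) x - iter t (expo_map b) 0) <=
  expo_lip b * (expo_lip b ^+ t * x) by rewrite ler_pM2l//; lra.
lra.
Qed.

(* Just to the right of 0 the first [q] iterates avoid the break points, so that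
   the [q]-th iterate is strictly convex there. *)
Lemma expo_map_iter_not_translation b q k : 0 < b -> (0 < q)%N ->
  ~ (forall x, 0 <= x -> iter q (expo_map b) x = x + k%:R).
Proof.
move=> b0 q0 H; have hb := expo_map_lift b0.
have L0 : 0 < expo_lip b by rewrite divr_gt0 ?mulr_gt0 ?expR_gt0 ?expRB1_gt0.
pose f t := iter t (expo_map b).
have f0 t : 0 <= f t 0 by exact: iter_lift_ge0.
(* Each of the first [q] images of [[0, z]] stays in one closed interval between integers. The gap
   [g] above the [q]-th image of 0 is positive, and the Lipschitz constant of the iterate tells how
   small [z] must be. *)
have [z z0 hz] : exists2 z, 0 < z & forall t, (t < q)%N ->
    f t z <= (Num.truncn (f t 0)).+1%:R.
  clear q0 H; elim: q => [|q [z z0 hz]]; first by exists 1.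
  set g := (Num.truncn (f q 0)).+1%:R - f q 0.
  have g0 : 0 < g by rewrite subr_gt0 truncnS_gt.
  pose w := Num.min z (g / expo_lip b ^+ q).
  have w0 : 0 < w by rewrite lt_min z0 divr_gt0// exprn_gt0.
  exists w => // t; rewrite ltnS leq_eqVlt => /predU1P[->|tq].
    apply: le_trans (expo_map_iter_lipschitz q b0 (ltW w0)) _.
    have : expo_lip b ^+ q * w <= g.
      by rewrite mulrC -ler_pdivlMr ?exprn_gt0// /w ge_min lexx orbT.
    by rewrite /g -/(f q); lra.
  apply: le_trans (hz _ tq).
  by apply: iter_lift_homo => //; [exact: ltW|rewrite ge_min lexx].
have lt t : f t 0 < f t z.
  by elim: t => //= t IH; apply: expo_map_lt.
have mid t : (t < q)%N -> f t.+1 (z / 2) < (f t.+1 0 + f t.+1 z) / 2.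
  elim: t => [|t IH] tq.
    have := hz 0 tq; rewrite /f /= truncn0 => z1.
    by have := @expo_map_midpoint b 0 z 0 b0 (lexx _) z0 z1; rewrite add0r.
  have {IH} IH := IH (ltnW tq).
  apply: (@le_lt_trans _ _ (expo_map b ((f t.+1 0 + f t.+1 z) / 2))).
    apply: expo_map_le => //; last exact: ltW.
    by apply: (@iter_lift_ge0 _ (expo_map b) (z / 2) t.+1) => //; lra.
  apply: (@expo_map_midpoint b (f t.+1 0) (f t.+1 z) (Num.truncn (f t.+1 0))) => //.
    by have /andP[] := truncn_itv (f0 t.+1).
  exact: hz.
have := mid q.-1; rewrite prednK// /f => /(_ (leqnn _)).
by rewrite !H; lra.
Qed.

(** A monotone function that takes a value twice is constant in between. Unless it is constant on
    [[l, r]], the intermediate value theorem supplies a rational value at an interior point, and it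
    remains to find a second point with this value. *)
Lemma expo_rotation_plateau (l r : R) : 0 < l -> l < r ->
  exists l' r', [/\ l <= l', l' < r', r' <= r &
    forall x y, l' <= x <= r' -> l' <= y <= r' -> expo_rotation x = expo_rotation y].
Proof.
move=> l0 lr.
have flat a b : 0 < a -> expo_rotation a = expo_rotation b ->
    forall x y, a <= x <= b -> a <= y <= b -> expo_rotation x = expo_rotation y.
  move=> a0 e.
  have E z : a <= z <= b -> expo_rotation z = expo_rotation a.
    move=> /andP[az zb]; apply/le_anti/andP; split; first exact: expo_rotation_antitone.
    by rewrite e; apply: expo_rotation_antitone zb; exact: lt_le_trans az.
  by move=> x y /E -> /E ->.
have := expo_rotation_antitone l0 (ltW lr).
rewrite le_eqVlt => /predU1P[e|rot_lt].
  by exists l, r; split; [exact: lexx|exact: lr|exact: lexx|exact: flat l0 (esym e)].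
have [s] := rat_in_itvoo rot_lt; rewrite in_itv /= => /andP[s1 s2].
have r0 : 0 < r by exact: lt_trans lr.
have [k [q [q0 es]]] : exists k q : nat, (0 < q)%N /\ ratr s = k%:R / q%:R :> R.
  have s0 : 0 <= s by rewrite -(ler0q R) ltW// (le_lt_trans (expo_rotation_ge0 r0) s1).
  exists `|numq s|%N, `|denq s|%N; split; first by rewrite absz_gt0 denq_eq0.
  rewrite /ratr; congr (_ / _).
    by rewrite pmulrn gez0_abs// numq_ge0.
  by rewrite pmulrn gez0_abs// ltW// denq_gt0.
rewrite es in s1 s2.
have cont : {within `[l, r], continuous expo_rotation}.
  apply: continuous_in_subspaceT => x; rewrite inE /= in_itv /= => /andP[lx _].
  by apply: expo_rotation_continuous; exact: lt_le_trans lx.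
have [b + eb] : exists2 b, b \in `[l, r] & expo_rotation b = k%:R / q%:R.
  apply: IVT => //; first exact: ltW.
  by rewrite ge_min (ltW s1) orbT le_max (ltW s2).
rewrite in_itv /= => /andP[lb br].
have {}lb : l < b.
  by rewrite lt_neqAle lb andbT; apply/eqP => lb'; move: s2; rewrite lb' eb ltxx.
have {}br : b < r.
  by rewrite lt_neqAle br andbT; apply/eqP => lb'; move: s1; rewrite -lb' eb ltxx.
have b0 : 0 < b by exact: lt_trans lb.
have [[a [/andP[la ab] ea]]|Ha] :=
    pselect (exists a, l < a < b /\ expo_rotation a = k%:R / q%:R).
  exists a, b; split; [exact: ltW|by []|exact: ltW|].
  by apply: flat (etrans ea (esym eb)); exact: lt_trans la.
have [[a [/andP[ba ar] ea]]|Hb] :=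
    pselect (exists a, b < a < r /\ expo_rotation a = k%:R / q%:R).
  exists b, a; split; [exact: ltW|by []|exact: ltW|].
  exact: flat b0 (etrans eb (esym ea)).
(* At each [a > b] the rotation number is now below [k / q], so the [q]-th iterate moves every [x]
   by less than [k]; at each [a < b] it moves [x] by more than [k]. Continuity in the parameter
   gives both weak inequalities at [b]. *)
exfalso; apply: (@expo_map_iter_not_translation b q k b0 q0) => x x0.
have cx := @expo_map_iter_cvg b x q b0 x0.
apply/eqP; rewrite eq_le; apply/andP; split.
- have cr : iter q (expo_map b') x @[b' --> b^'+] --> iter q (expo_map b) x.
    exact: cvg_at_right_filter.
  apply: (cvgr_to_le cr).
  near=> a.
  have ba : b < a by near: a; exact: nbhs_right_gt.
  have ar : a < r by near: a; exact: nbhs_right_lt.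
  have a0 : 0 < a by exact: lt_trans ba.
  rewrite leNgt; apply/negP => /ltW h.
  have := rotation_number_ge_ratio (expo_map_lift a0) x0 q0 h.
  rewrite -/(expo_rotation a) => h1; apply: Hb; exists a; split; first by rewrite ba.
  apply/eqP; rewrite eq_le h1 andbT -eb.
  exact: expo_rotation_antitone (ltW _).
- have cr : iter q (expo_map b') x @[b' --> b^'-] --> iter q (expo_map b) x.
    exact: cvg_at_left_filter.
  apply: (cvgr_to_ge cr).
  near=> a.
  have ba : a < b by near: a; exact: nbhs_left_lt.
  have ar : l < a by near: a; exact: nbhs_left_gt.
  have a0 : 0 < a by exact: lt_trans ar.
  rewrite leNgt; apply/negP => /ltW h.
  have := rotation_number_le_ratio (expo_map_lift a0) x0 q0 h.
  rewrite -/(expo_rotation a) => h1; apply: Ha; exists a; split; first by rewrite ar.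
  apply/eqP; rewrite eq_le h1 -eb.
  exact: expo_rotation_antitone (ltW _).
Unshelve. all: by end_near.
Qed.

End ExponentialCircleMap.

(** * The limit function is a Devil's staircase *)

Section LimitActivity.
Context {R : realType}.
Implicit Types p mu : R.

Definition limit_activity p mu : R := if mu <= 0 then 0 else expo_rotation (p / mu).

Lemma limit_activity_gt0 p mu : 0 < mu -> limit_activity p mu = expo_rotation (p / mu).
Proof. by rewrite /limit_activity ltNge => /negbTE ->. Qed.

Lemma limit_activity_ge0 p mu : 0 < p -> 0 <= limit_activity p mu.
Proof.
move=> p0; have [mu0|mu0] := leP mu 0; first by rewrite /limit_activity mu0.
by rewrite limit_activity_gt0// expo_rotation_ge0// divr_gt0.
Qed.

Lemma limit_activity_homo p mu mu' : 0 < p -> mu <= mu' ->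
  limit_activity p mu <= limit_activity p mu'.
Proof.
move=> p0 le; have [mu0|mu0] := leP mu 0.
  by rewrite {1}/limit_activity mu0 limit_activity_ge0.
have mu'0 : 0 < mu' by exact: lt_le_trans le.
rewrite !limit_activity_gt0//; apply: expo_rotation_antitone; first by rewrite divr_gt0.
by rewrite ler_pM2l// lef_pV2.
Qed.

Lemma limit_activity_continuous p : 0 < p ->
  {in `[0, p / ln 2], continuous (limit_activity p)}.
Proof.
move=> p0 x; rewrite in_itv /= => /andP[x0 _].
move: x0; rewrite le_eqVlt => /predU1P[<-|x0].
  apply/cvgrPdist_le => e e0; near=> mu.
  suff -> : limit_activity p mu = limit_activity p 0 by rewrite subrr normr0 ltW.
  have small : mu < p / 4 by near: mu; apply: lt_nbhsl; rewrite divr_gt0.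
  rewrite {2}/limit_activity lexx.
  have [mu0|mu0] := leP mu 0; first by rewrite /limit_activity mu0.
  rewrite limit_activity_gt0// expo_rotation_eq0// ler_pdivlMr// -ler_pdivlMl// mulrC.
  exact: ltW.
apply/cvgrPdist_le => e e0; rewrite limit_activity_gt0//.
have c : expo_rotation (p / mu) @[mu --> x] --> expo_rotation (p / x).
  have px : 0 < p / x by rewrite divr_gt0.
  have := @cvg_comp _ _ _ (fun mu => p / mu) expo_rotation (nbhs x) (nbhs (p / x)).
  apply; last exact: expo_rotation_continuous.
  by apply: cvgM; [exact: cvg_cst|apply: cvgV; [rewrite gt_eqF|exact: cvg_id]].
move/cvgrPdist_le/(_ _ e0) : c => c.
near=> mu.
have mu0 : 0 < mu by near: mu; exact: lt_nbhsr.
by rewrite limit_activity_gt0//; near: mu.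
Unshelve. all: by end_near.
Qed.

Lemma limit_activity_plateau p (l r : R) : 0 < p -> 0 < l -> l < r ->
  exists l' r', [/\ l <= l', l' < r', r' <= r &
    forall x y, l' <= x <= r' -> l' <= y <= r' -> limit_activity p x = limit_activity p y].
Proof.
move=> p0 l0 lr; have r0 : 0 < r by exact: lt_trans lr.
have pr : 0 < p / r by rewrite divr_gt0.
have prl : p / r < p / l by rewrite ltr_pM2l// ltf_pV2.
have [a [b [ra ab bl flat]]] := expo_rotation_plateau pr prl.
have a0 : 0 < a by exact: lt_le_trans ra.
have b0 : 0 < b by exact: lt_trans ab.
have swap (y z : R) : 0 < y -> 0 < z -> (y <= p / z) = (z <= p / y).
  by move=> y0 z0; rewrite !ler_pdivlMr// mulrC.
have swap' (y z : R) : 0 < y -> 0 < z -> (p / z <= y) = (p / y <= z).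
  by move=> y0 z0; rewrite !ler_pdivrMr// mulrC.
exists (p / b), (p / a); split.
- by rewrite -swap.
- by rewrite ltr_pM2l// ltf_pV2.
- by rewrite -swap'.
- have flip x : p / b <= x <= p / a -> 0 < x /\ a <= p / x <= b.
    move=> /andP[bx xa]; have x0 : 0 < x by apply: lt_le_trans bx; rewrite divr_gt0.
    by rewrite x0 swap// xa swap'.
  move=> x y /flip[x0 hx] /flip[y0 hy].
  by rewrite (limit_activity_gt0 p x0) (limit_activity_gt0 p y0); exact: flat.
Qed.

Lemma limit_activity_staircase p : 0 < p ->
  devils_staircase 0 (p / ln 2) (limit_activity p).
Proof.
move=> p0; have ln20 : 0 < ln 2 :> R by rewrite ln_gt0// ltr1n.
set b := p / ln 2; have b0 : 0 < b by rewrite divr_gt0.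
have cb : limit_activity p b = 1.
  by rewrite limit_activity_gt0// /b invfM invrK mulrA divff ?gt_eqF// mul1r expo_rotation_ln2.
split.
- apply: continuous_in_subspaceT => x; rewrite inE /= => xb.
  exact: (limit_activity_continuous p0 xb).
- by move=> x y _ _; exact: limit_activity_homo.
- move=> x; rewrite in_itv /= => /andP[_ xb].
  by rewrite limit_activity_ge0//= -cb limit_activity_homo.
- by split=> //; rewrite /limit_activity lexx.
pose flat (l r : R) := forall y z, l < y < r -> l < z < r ->
  limit_activity p y = limit_activity p z.
exists [set x | exists l r, l < x < r /\ flat l r]; split.
- rewrite openE => x [l [r [lxr fl]]].
  have : \forall y \near x, y \in `]l, r[ by apply: near_in_itvoo; rewrite in_itv.
  by apply: filterS => y; rewrite in_itv /= => lyr; exists l, r.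
- move=> x; rewrite /= in_itv /= => /andP[x0 xb] B /nbhs_ballP[e /= e0 eB].
  pose l0 := Num.max (x - e / 2) 0; pose r0 := Num.min (x + e / 2) b.
  have lr0 : l0 < r0.
    by rewrite gt_max !lt_min; apply/andP; split; apply/andP; split; lra.
  have l0x : x - e / 2 <= l0 by rewrite le_max lexx.
  have l00 : 0 <= l0 by rewrite le_max lexx orbT.
  have r0x : r0 <= x + e / 2 by rewrite ge_min lexx.
  have r0b : r0 <= b by rewrite ge_min lexx orbT.
  clearbody l0 r0.
  (* The middle third of [[l0, r0]] has a positive left end, even when [l0 = 0], and its points stay
     inside both the ball and [[0, b]]. *)
  have := @limit_activity_plateau p ((2 * l0 + r0) / 3) ((l0 + 2 * r0) / 3) p0.
  move=> /(_ ltac:(lra) ltac:(lra)) [l [r [hl lr hr fl]]].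
  exists ((l + r) / 2); split.
    split; last by rewrite /= in_itv /=; apply/andP; split; lra.
    exists l, r; split; first by apply/andP; split; lra.
    by move=> y z /andP[? ?] /andP[? ?]; apply: fl; apply/andP; split; lra.
  by apply: eB; rewrite /ball /= ltr_norml; apply/andP; split; lra.
- move=> x [[l [r [lxr fl]]] _].
  have : \forall y \near x, y \in `]l, r[ by apply: near_in_itvoo; rewrite in_itv.
  by apply: filterS => y; rewrite in_itv /= => lyr _; exact: fl.
Qed.

Lemma expo_rotation_left_approx (b e : R) : 0 < b -> 0 < e ->
  exists2 b0, 0 < b0 < b & expo_rotation b0 <= expo_rotation b + e.
Proof.
move=> b0 e0.
have /cvgrPdist_le/(_ _ e0)/nbhs_ballP[r /= r0 rH] := @expo_rotation_continuous R b b0.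
pose a := Num.max (b - r / 2) (b / 2).
have a1 : b - r / 2 <= a by rewrite le_max lexx.
have a2 : b / 2 <= a by rewrite le_max lexx orbT.
have a3 : a < b by rewrite gt_max; apply/andP; split; lra.
exists a; first by apply/andP; split; lra.
have ab : ball b r a by rewrite /ball /= ltr_norml; apply/andP; split; lra.
by have := rH a ab; rewrite ler_norml => /andP[h _]; rewrite -lerBlDl -opprB lerNl.
Qed.

Lemma expo_rotation_right_approx (b e : R) : 0 < b -> 0 < e ->
  exists2 b0, b < b0 & expo_rotation b - e <= expo_rotation b0.
Proof.
move=> b0 e0.
have /cvgrPdist_le/(_ _ e0)/nbhs_ballP[r /= r0 rH] := @expo_rotation_continuous R b b0.
exists (b + r / 2); first lra.
have ab : ball b r (b + r / 2) by rewrite /ball /= ltr_norml; apply/andP; split; lra.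
by have := rH _ ab; rewrite ler_norml => /andP[_ h]; rewrite lerBlDr -lerBlDl.
Qed.

End LimitActivity.

(** * Parallel chip-firing on a finite graph *)

Lemma truncn_natrD {R : realType} (x : R) k : 0 <= x ->
  Num.truncn (x + k%:R) = (Num.truncn x + k)%N.
Proof.
move=> x0; have /andP[h1 h2] := truncn_itv x0.
by apply: truncn_def; rewrite -addSn !natrD lerD2r h1 ltrD2r.
Qed.

Section Odometer.
Context {R : realType} {V : finType}.
Implicit Types (e : rel V) (sigma : V -> R) (v w : V).

Lemma odometerS e sigma t v :
  odometer e sigma t.+1 v =
  (odometer e sigma t v + firings e (iter t (parallel_step e) sigma) v)%N.
Proof. by rewrite /odometer big_ord_recr. Qed.

Lemma configuration_odometer e sigma t v :
  iter t (parallel_step e) sigma v =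
  sigma v - (odometer e sigma t v * degree e v)%:R +
  (\sum_(w | e v w) odometer e sigma t w)%:R.
Proof.
elim: t v => [|t IH] v.
  by rewrite /= /odometer big_ord0 mul0n subr0 big1 ?addr0// => w _; rewrite big_ord0.
rewrite iterS /parallel_step -/(parallel_step e) IH.
under [in RHS]eq_bigr do rewrite odometerS.
rewrite odometerS big_split /= mulnDl !natrD.
lra.
Qed.

Lemma configuration_ge0 e sigma t v :
  (forall v, 0 <= sigma v) -> 0 <= iter t (parallel_step e) sigma v.
Proof.
move=> s0; elim: t v => [|t IH] v //=.
rewrite /parallel_step addr_ge0// subr_ge0 natrM /firings.
have [->|d0] := posnP (degree e v); first by rewrite mulr0.
by rewrite -ler_pdivlMr ?ltr0n// truncn_le divr_ge0.
Qed.

Lemma configuration_sum e sigma t : symmetric e ->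
  \sum_v iter t (parallel_step e) sigma v = \sum_v sigma v.
Proof.
move=> esym; elim: t => [//|t <-]; rewrite iterS /parallel_step -/(parallel_step e).
set s := iter t _ _; set f := firings e s.
rewrite big_split sumrB /= -!natr_sum.
suff -> : (\sum_v \sum_(w | e v w) f w = \sum_v f v * degree e v)%N by lra.
rewrite (exchange_big_dep predT)//=; apply: eq_bigr => w _.
by rewrite sum_nat_const mulnC; congr (_ * _)%N; apply: eq_card => x; rewrite !inE esym.
Qed.

(** The odometer recursion as an operator on integer functions. Like a circle lift, it is monotone
    and commutes with adding a constant. *)
Definition topple e sigma (u : V -> nat) : V -> nat :=
  fun v => Num.truncn ((sigma v + (\sum_(w | e v w) u w)%:R) / (degree e v)%:R).

Definition no_isolated e := forall v, (0 < degree e v)%N.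

(** The past firings of [v] are an integer and can be moved inside the floor; there they cancel the
    chips that [v] has sent away. *)
Lemma odometer_topple e sigma t : (forall v, 0 <= sigma v) -> no_isolated e ->
  odometer e sigma t = iter t (topple e sigma) (fun=> 0%N).
Proof.
move=> s0 d0; elim: t => [|t IH]; first by apply/funext => v; rewrite /odometer big_ord0.
apply/funext => v; rewrite iterS -IH odometerS addnC /firings -truncn_natrD; last first.
  by rewrite divr_ge0// configuration_ge0.
have dv : (degree e v)%:R != 0 :> R by rewrite pnatr_eq0 -lt0n.
rewrite /topple configuration_odometer; congr Num.truncn.
by rewrite natrM addrAC mulrBl mulfK// subrK.
Qed.

Lemma topple_addn e sigma u k v : no_isolated e -> (forall v, 0 <= sigma v) ->
  topple e sigma (fun w => u w + k)%N v = (topple e sigma u v + k)%N.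
Proof.
move=> d0 s0; rewrite -truncn_natrD ?divr_ge0 ?addr_ge0//; congr Num.truncn.
have dv : (degree e v)%:R != 0 :> R by rewrite pnatr_eq0 -lt0n.
rewrite -[k%:R](@mulfK _ (degree e v)%:R)// -mulrDl -addrA -natrM -natrD.
by rewrite mulnC -sum_nat_const big_split.
Qed.

Lemma iter_topple_addn e sigma u k t : no_isolated e -> (forall v, 0 <= sigma v) ->
  iter t (topple e sigma) (fun w => u w + k)%N =
  (fun w => iter t (topple e sigma) u w + k)%N.
Proof.
by move=> d0 s0; elim: t => //= t ->; apply/funext => v; rewrite topple_addn.
Qed.

Lemma iter_topple_homo e sigma sigma' u u' t : (forall v, sigma v <= sigma' v) ->
  (forall v, u v <= u' v)%N ->
  forall v, (iter t (topple e sigma) u v <= iter t (topple e sigma') u' v)%N.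
Proof.
move=> ss' uu'; elim: t => [//|t IH] v /=; apply: le_truncn.
rewrite ler_wpM2r ?invr_ge0// lerD// ler_nat.
by apply: leq_sum => w _; exact: IH.
Qed.

Definition common_neighbours e := forall v w, v != w -> exists x, e v x && e w x.

(** No vertex ever holds more than the total [N], so the net inflow, which is the sum of [u y - u x]
    over the neighbours [y] of [x], is at most [N]. At a minimum [m] of [u] all terms are
    nonnegative and bound [u] on the neighbours of [m]; one more step reaches every vertex. *)
Lemma odometer_oscillation e sigma : symmetric e -> common_neighbours e ->
  (forall v, 0 <= sigma v) ->
  exists C : nat, forall t v w, (odometer e sigma t w <= odometer e sigma t v + C)%N.
Proof.
move=> esym cn s0; set N := \sum_v sigma v.
have N0 : 0 <= N by rewrite sumr_ge0.
exists (Num.truncn ((#|V|%:R + 2) * N)).+1 => t v w; set u := odometer e sigma t.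
have flow x : \sum_(y | e x y) ((u y)%:R - (u x)%:R) <= N.
  rewrite sumrB -natr_sum sumr_const -(mulr_natr _ #|_|).
  have -> : #|[pred y | e x y]| = degree e x by [].
  have : iter t (parallel_step e) sigma x <= N.
    rewrite /N -(configuration_sum sigma t esym) (bigD1 x)//= lerDl sumr_ge0// => y _.
    exact: configuration_ge0.
  rewrite configuration_odometer -/u natrM; have := s0 x; lra.
case: (@arg_minnP _ v predT u) => // m _ umin.
suff h : (u w <= u m + (Num.truncn ((#|V|%:R + 2) * N)).+1)%N.
  by apply: leq_trans h _; rewrite leq_add2r umin.
rewrite -(ler_nat R) natrD.
apply: (@le_trans _ _ ((u m)%:R + (#|V|%:R + 2) * N)); last first.
  by rewrite lerD2l ltW// truncnS_gt.
have [->|wm] := eqVneq w m.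
  by rewrite lerDl mulr_ge0// addr_ge0.
have [x /andP[wx mx]] := cn _ _ wm.
have h1 : (u x)%:R - (u m)%:R <= N.
  apply: le_trans (flow m); rewrite (bigD1 x)//= lerDl sumr_ge0// => y _.
  by rewrite subr_ge0 ler_nat umin.
(* Adding [N] makes every term of the flow at [x] nonnegative, since [u y >= u m >= u x - N]. *)
have h2 : (u w)%:R - (u x)%:R + N <= N + #|V|%:R * N.
  apply: (@le_trans _ _ (\sum_(y | e x y) ((u y)%:R - (u x)%:R + N))).
    rewrite (bigD1 w)/= 1?esym// lerDl sumr_ge0// => y _.
    have : (u m)%:R <= (u y)%:R :> R by rewrite ler_nat umin.
    lra.
  rewrite big_split /= lerD//.
  by rewrite sumr_const -(mulr_natl N) ler_wpM2r// ler_nat max_card.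
lra.
Qed.

(** At time [s] the odometer is within [C] of the constant [u_s(v0)]. Applying [topple] for [t] more
    steps preserves this comparison, so [u_(s+t)(v0)] is [u_s(v0) + u_t(v0)] up to [C]; a second [C]
    passes from [v0] to the other vertices. *)
Lemma odometer_slope e sigma : symmetric e -> common_neighbours e -> no_isolated e ->
  (forall v, 0 <= sigma v) ->
  exists a C : R, forall t v, `|(odometer e sigma t v)%:R - t%:R * a| <= C.
Proof.
move=> esym cn d0 s0; have [C osc] := odometer_oscillation esym cn s0.
have [v0 _|V0] := pickP (@predT V); last by exists 0, 0 => t v; have := V0 v.
have qa s t : `|(odometer e sigma (s + t) v0)%:R - (odometer e sigma s v0)%:R -
    (odometer e sigma t v0)%:R| <= C%:R :> R.
  have E : odometer e sigma (s + t) = iter t (topple e sigma) (odometer e sigma s).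
    by rewrite addnC !odometer_topple// iterD.
  set k := odometer e sigma s v0.
  have T0 j : iter t (topple e sigma) (fun=> j) v0 = (odometer e sigma t v0 + j)%N.
    have := iter_topple_addn (fun=> 0%N) j t d0 s0.
    by rewrite odometer_topple// => /(congr1 (fun f => f v0)).
  have h1 : (odometer e sigma (s + t) v0 <= odometer e sigma t v0 + (k + C))%N.
    by rewrite E -T0; apply: iter_topple_homo => // v; exact: osc.
  have h2 : (odometer e sigma t v0 + k <= odometer e sigma (s + t) v0 + C)%N.
    have := iter_topple_addn (odometer e sigma s) C t d0 s0.
    rewrite -E => /(congr1 (fun f => f v0)) /= <-.
    by rewrite -T0; apply: iter_topple_homo => // v; exact: osc.
  move: h1 h2; rewrite -!(ler_nat R) !natrD ler_norml -/k; lra.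
have [a ha] := quasi_additive_slope qa.
exists a, (C%:R + C%:R) => t v.
have := ha t; have := osc t v v0; have := osc t v0 v.
rewrite -!(ler_nat R) !natrD !ler_norml; lra.
Qed.

(** The common limit exists, so [xget] returns it rather than the default value. *)
Lemma activity_slope e sigma : symmetric e -> common_neighbours e -> no_isolated e ->
  (forall v, 0 <= sigma v) ->
  exists C : R, forall t v, `|(odometer e sigma t v)%:R - t%:R * activity e sigma| <= C.
Proof.
move=> esym cn d0 s0; have [a [C h]] := odometer_slope esym cn d0 s0.
exists C => t v.
have ia : is_activity e sigma a.
  by move=> w; apply: bounded_deviation_cvg => n; exact: h.
suff -> : activity e sigma = a by exact: h.
rewrite /activity; case: xgetP => [b _ ib|]; last by move=> /(_ a).
exact: (cvg_unique _ (ib v) (ia v)).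
Qed.

Lemma activity_le e sigma sigma' (v0 : V) : symmetric e -> common_neighbours e ->
  no_isolated e -> (forall v, 0 <= sigma v) -> (forall v, sigma v <= sigma' v) ->
  activity e sigma <= activity e sigma'.
Proof.
move=> esym cn d0 s0 ss'.
have s'0 v : 0 <= sigma' v by exact: le_trans (s0 _) (ss' _).
have [C h] := activity_slope esym cn d0 s0.
have [C' h'] := activity_slope esym cn d0 s'0.
rewrite -subr_le0; apply: (@le0_natmul_bounded _ _ (C + C')) => j.
have := @iter_topple_homo e sigma sigma' (fun=> 0%N) (fun=> 0%N) j ss' (fun=> leqnn _) v0.
rewrite -!odometer_topple// -(ler_nat R).
have := h j v0; have := h' j v0; rewrite !ler_norml; lra.
Qed.

Lemma activity_ge0 e sigma (v0 : V) : symmetric e -> common_neighbours e ->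
  no_isolated e -> (forall v, 0 <= sigma v) -> 0 <= activity e sigma.
Proof.
move=> esym cn d0 s0; have [C h] := activity_slope esym cn d0 s0.
rewrite -oppr_le0; apply: (@le0_natmul_bounded _ _ C) => j.
have := h j v0; have : 0 <= (odometer e sigma j v0)%:R :> R by [].
rewrite ler_norml; lra.
Qed.

Lemma truncn_sum_shift e sigma v r k : (forall v, 0 <= sigma v) -> 0 <= r ->
  (\sum_(w | e v w) Num.truncn (sigma w / (degree e w)%:R + (r + k%:R)))%:R =
  (\sum_(w | e v w) Num.truncn (sigma w / (degree e w)%:R + r))%:R
  + (degree e v)%:R * k%:R :> R.
Proof.
move=> s0 r0; rewrite -natrM -natrD -sum_nat_const -big_split /=; congr (_%:R).
by apply: eq_bigr => w _; rewrite addrA truncn_natrD// addr_ge0// divr_ge0.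
Qed.

(** The induction bounds neighbour averages. A single vertex can exceed [F^t(0)], but by no more
    than its own [sigma v / deg v], which does not affect the slope. Values of [r] in [[0, 1[]
    suffice since both sides shift alike under integers. *)
Lemma activity_le_rotation e sigma F (v0 : V) : symmetric e -> common_neighbours e ->
  no_isolated e -> (forall v, 0 <= sigma v) -> circle_lift F ->
  (forall v r, 0 <= r < 1 ->
    (\sum_(w | e v w) Num.truncn (sigma w / (degree e w)%:R + r))%:R <=
    (degree e v)%:R * F r) ->
  activity e sigma <= rotation_number F.
Proof.
move=> esym cn d0 s0 hF H0.
have H v r : 0 <= r -> (\sum_(w | e v w) Num.truncn (sigma w / (degree e w)%:R + r))%:R <=
    (degree e v)%:R * F r.
  move=> r0; have /andP[k1 k2] := truncn_itv r0; set k := Num.truncn r in k1 k2.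
  have f01 : 0 <= r - k%:R < 1 by rewrite -natr1 in k2; apply/andP; split; lra.
  have /andP[f0 _] := f01.
  rewrite -[r](subrK k%:R) truncn_sum_shift// lift_natr// mulrDr lerD2r.
  exact: H0.
have F0 t : 0 <= iter t F 0 by exact: iter_lift_ge0.
have dgt0 v : (0 : R) < (degree e v)%:R by rewrite ltr0n.
have step t w : (\sum_(x | e w x) odometer e sigma t x)%:R <=
      (degree e w)%:R * iter t F 0 ->
    (odometer e sigma t.+1 w <=
      Num.truncn (sigma w / (degree e w)%:R + iter t F 0%R))%N.
  move=> IH; rewrite !odometer_topple// iterS -odometer_topple//; apply: le_truncn.
  by rewrite mulrDl lerD2l ler_pdivrMr// mulrC.
have avg t v : (\sum_(w | e v w) odometer e sigma t w)%:R <= (degree e v)%:R * iter t F 0.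
  elim: t v => [|t IH] v.
    by rewrite big1 ?mulr0// => w _; rewrite /odometer big_ord0.
  apply: le_trans (H v _ (F0 t)); rewrite ler_nat; apply: leq_sum => w _.
  exact: step (IH w).
have [C h] := activity_slope esym cn d0 s0.
have [_ h'] := rotation_number_cvg hF.
rewrite -subr_le0; set K := sigma v0 / (degree e v0)%:R.
apply: (@le0_natmul_bounded _ _ (C + K + 1)) => j.
have : (odometer e sigma j v0 <= odometer e sigma j.+1 v0)%N.
  by rewrite odometerS leq_addr.
have := step j v0 (avg j v0); rewrite -/K => h1 h2.
have := leq_trans h2 h1; rewrite -(ler_nat R) => h3.
have K0 : 0 <= K by rewrite divr_ge0.
have /andP[h4 _] := truncn_itv (addr_ge0 K0 (F0 j)).
have := h j v0; have := h' j; rewrite !ler_norml; lra.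
Qed.

Lemma activity_ge_rotation e sigma F (v0 : V) : symmetric e -> common_neighbours e ->
  no_isolated e -> (forall v, 0 <= sigma v) -> circle_lift F ->
  (forall v r, 0 <= r < 1 -> (degree e v)%:R * F r <=
    (\sum_(w | e v w) Num.truncn (sigma w / (degree e w)%:R + r))%:R) ->
  rotation_number F <= activity e sigma.
Proof.
move=> esym cn d0 s0 hF H0.
have H v r : 0 <= r -> (degree e v)%:R * F r <=
    (\sum_(w | e v w) Num.truncn (sigma w / (degree e w)%:R + r))%:R.
  move=> r0; have /andP[k1 k2] := truncn_itv r0; set k := Num.truncn r in k1 k2.
  have f01 : 0 <= r - k%:R < 1 by rewrite -natr1 in k2; apply/andP; split; lra.
  have /andP[f0 _] := f01.
  rewrite -[r](subrK k%:R) truncn_sum_shift// lift_natr// mulrDr lerD2r.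
  exact: H0.
have F0 t : 0 <= iter t F 0 by exact: iter_lift_ge0.
have dgt0 v : (0 : R) < (degree e v)%:R by rewrite ltr0n.
have step t w : (degree e w)%:R * iter t F 0 <=
      (\sum_(x | e w x) odometer e sigma t x)%:R ->
    (Num.truncn (sigma w / (degree e w)%:R + iter t F 0%R) <=
      odometer e sigma t.+1 w)%N.
  move=> IH; rewrite !odometer_topple// iterS -odometer_topple//; apply: le_truncn.
  by rewrite mulrDl lerD2l ler_pdivlMr// mulrC.
have avg t v : (degree e v)%:R * iter t F 0 <= (\sum_(w | e v w) odometer e sigma t w)%:R.
  elim: t v => [|t IH] v; first by rewrite mulr0.
  apply: le_trans (H v _ (F0 t)) _; rewrite ler_nat; apply: leq_sum => w _.
  exact: step (IH w).
have [C h] := activity_slope esym cn d0 s0.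
have [_ h'] := rotation_number_cvg hF.
rewrite -subr_le0; set K := activity e sigma.
(* One unit is lost to the floor, one to the error of the rotation number, and [K] because the
   odometer is read at time [j + 1]. *)
apply: (@le0_natmul_bounded _ _ (C + K + 2)) => j.
have := step j v0 (avg j v0); rewrite -(ler_nat R) => h3.
have K0 : 0 <= sigma v0 / (degree e v0)%:R by rewrite divr_ge0.
have /andP[_] := truncn_itv (addr_ge0 K0 (F0 j)).
have := h j.+1 v0; have := h' j.
rewrite -!natr1 !ler_norml -/K; lra.
Qed.

End Odometer.

(** * Chernoff bounds *)

Section Concentration.
Context {R : realType} {d : measure_display} {Omega : measurableType d}
  (P : probability Omega R).

(** Integration of a pointwise bound. The coefficients may be negative, as they are in lower tail
    bounds. *)
Lemma probability_le_lincomb (J : finType) (Q : pred J) (A : set Omega)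
    (B : J -> set Omega) (c : J -> R) :
  measurable A -> (forall j, measurable (B j)) ->
  (forall w, \1_A w <= \sum_(j | Q j) c j * \1_(B j) w) ->
  (P A <= (\sum_(j | Q j) c j * fine (P (B j)))%:E)%E.
Proof.
move=> mA mB AB.
have iB j : P.-integrable setT (fun w => (c j)%:E * (\1_(B j) w)%:E)%E.
  by apply: integrableZl => //; exact: integrable_indic.
have -> : P A = (\int[P]_w (\1_A w)%:E)%E by rewrite integral_indic// setIT.
have -> : (\sum_(j | Q j) c j * fine (P (B j)))%:E =
    (\int[P]_w (\sum_(j | Q j) (c j)%:E * (\1_(B j) w)%:E))%E.
  rewrite integral_sum// -sumEFin; apply: eq_bigr => j _.
  rewrite integralZl//; last exact: integrable_indic.
  by rewrite integral_indic// setIT EFinM fineK// fin_num_measure.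
apply: le_integral => //; first exact: integrable_indic.
  exact: integrable_sum.
move=> w _; rewrite /=.
under eq_bigr do rewrite -EFinM.
by rewrite sumEFin lee_fin.
Qed.

Lemma probability_union_le (J : finType) (B : J -> set Omega) (b : R) :
  (forall j, measurable (B j)) -> (forall j, (P (B j) <= b%:E)%E) ->
  measurable [set w | exists j, B j w] /\
  (P [set w | exists j, B j w] <= (#|J|%:R * b)%:E)%E.
Proof.
move=> mB Bb.
have mU : measurable [set w | exists j, B j w].
  have -> : [set w | exists j, B j w] = \bigcup_(j in [set: J]) B j.
    by apply/seteqP; split=> w [j]; [move=> ?; exists j|move=> _ ?; exists j].
  by apply: fin_bigcup_measurable => //; exact: finite_finset.
split => //.
apply: (@le_trans _ _ (\sum_(j : J) 1 * fine (P (B j)))%:E).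
  apply: probability_le_lincomb => // w; rewrite indicE.
  have [|_] := boolP (w \in _); last by rewrite sumr_ge0// => j _; rewrite mul1r.
  rewrite inE => -[j Bj]; rewrite (bigD1 j)//= mul1r indicE mem_set// lerDl.
  by rewrite sumr_ge0// => i _; rewrite mul1r.
rewrite lee_fin mulr_natl -sumr_const; apply: ler_sum => j _.
by rewrite mul1r -lee_fin fineK// fin_num_measure.
Qed.

(** If [A i a] is the event [X_i > a], this is the event [X_i >= k]. *)
Definition level (I : Type) (A : I -> nat -> set Omega) (i : I) (k : nat) : set Omega :=
  if k is a.+1 then A i a else setT.

(** By nesting, the events that occur form an initial segment, along which the increments of
    [e^(theta a)] telescope. *)
Lemma expR_level_sum (A : nat -> set Omega) (theta : R) M w :
  (forall a, A a.+1 `<=` A a) ->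
  expR (theta * \sum_(a < M) \1_(A a) w) =
  1 + \sum_(a < M) (expR (theta * a.+1%:R) - expR (theta * a%:R)) * \1_(A a) w.
Proof.
move=> nest; elim: M => [|M IH]; first by rewrite !big_ord0 mulr0 expR0 addr0.
rewrite !big_ord_recr /= mulrDr expRD IH addrA indicE.
have [|_] := boolP (w \in A M); last by rewrite !mulr0 expR0 mulr1 addr0.
rewrite inE => AM.
have full k : (k <= M)%N -> A k w.
  move=> kM; rewrite -(subKn kM); elim: (M - k)%N => [|j jM]; first by rewrite subn0.
  have [jM'|Mj] := ltnP j M; last by have -> : (M - j.+1 = M - j)%N;
    first by rewrite (eqP Mj) (eqP (leqW Mj)).
  by apply: nest; rewrite -subSn// subSS.
have e : \sum_(a < M) \1_(A a) w = M%:R :> R.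
  rewrite (eq_bigr (fun=> 1)) => [|a _]; first by rewrite sumr_const card_ord.
  by rewrite indicE mem_set//; apply: full; exact: ltnW.
by rewrite -IH e !mulr1 -natr1 mulrDr mulr1 expRD; lra.
Qed.

(* [expR (theta * X)] is a linear combination of the indicators of the events
   [X > a], so the product rule is needed for these events but not for their
   complements. *)
Lemma level_chernoff (I : finType) (Q : pred I) (A : I -> nat -> set Omega) M
    (theta S : R) :
  (forall i a, Q i -> measurable (A i a)) ->
  (forall i a, Q i -> A i a.+1 `<=` A i a) ->
  (forall f : I -> nat, fine (P (\bigcap_(i in [set i | Q i]) level A i (f i))) =
    \prod_(i | Q i) fine (P (level A i (f i)))) ->
  let E := [set w | theta * S <= theta * \sum_(i | Q i) \sum_(a < M) \1_(A i a) w] in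
  measurable E /\
  (P E <=
   (expR (- (theta * S)) * \prod_(i | Q i)
     (1 + \sum_(a < M) (expR (theta * a.+1%:R) - expR (theta * a%:R)) *
        fine (P (A i a))))%:E)%E.
Proof.
move=> mA nest prod E.
have mE : measurable E.
  rewrite -[E]setTI; apply: measurable_fun_le => //.
  apply: measurable_realfun.measurable_funM => //.
  under eq_fun do rewrite big_mkcond /=.
  apply: measurable_sum => i; have [Qi|//] := boolP (Q i).
  by apply: measurable_sum => a; apply: measurable_realfun.measurable_indic; exact: mA.
split=> //.
have ml i k : Q i -> measurable (level A i k) by case: k => [|k] //=; exact: mA.
pose c (k : 'I_M.+1) : R :=
  if val k is a.+1 then expR (theta * a.+1%:R) - expR (theta * a%:R) else 1.
have sumc (g : nat -> R) : \sum_(k : 'I_M.+1) c k * g k =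
    g 0 + \sum_(a < M) (expR (theta * a.+1%:R) - expR (theta * a%:R)) * g a.+1.
  by rewrite big_ord_recl /= /c/= mul1r.
(* Distributing the product over the sums gives one term for each choice [f] of a level at every
   index; the product rule applies to each term. *)
have -> : \prod_(i | Q i)
     (1 + \sum_(a < M) (expR (theta * a.+1%:R) - expR (theta * a%:R)) *
        fine (P (A i a))) =
  \sum_(f in pffun_on ord0 Q predT) (\prod_(i | Q i) c (f i)) *
     fine (P (\bigcap_(i in [set i | Q i]) level A i (f i))).
  under [RHS]eq_bigr do rewrite (prod (fun i => val (_ i))) -big_split.
  rewrite -(@big_distr_big _ _ _ _ _ _ _ ord0 Q predT
    (fun i (k : 'I_M.+1) => c k * fine (P (level A i k)))).
  apply: eq_bigr => i _; rewrite (sumc (fun k => fine (P (level A i k)))) /=.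
  by rewrite probability_setT.
rewrite mulr_sumr.
under eq_bigr do rewrite mulrA.
apply: probability_le_lincomb => // [f|w].
  by apply: fin_bigcap_measurable => [|i Qi]; [exact: finite_finset|exact: ml].
rewrite indicE.
under eq_bigr do rewrite -mulrA.
rewrite -mulr_sumr.
have -> : \sum_(f in pffun_on ord0 Q predT) (\prod_(i | Q i) c (f i)) *
     \1_(\bigcap_(i in [set i | Q i]) level A i (f i)) w =
   expR (theta * \sum_(i | Q i) \sum_(a < M) \1_(A i a) w).
  rewrite mulr_sumr expR_sum.
  transitivity (\prod_(i | Q i) \sum_(k : 'I_M.+1) c k * \1_(level A i k) w).
    rewrite (@big_distr_big _ _ _ _ _ _ _ ord0 Q predT
      (fun i (k : 'I_M.+1) => c k * \1_(level A i k) w)).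
    apply: eq_bigr => f _; rewrite big_split /=; congr (_ * _).
    rewrite indicE; have [|] := boolP (w \in _).
      rewrite inE => h; rewrite big1// => i Qi; rewrite indicE mem_set//.
      exact: h.
    rewrite notin_setE => h; have [i Qi ni] : exists2 i, Q i & ~ level A i (f i) w.
      by apply: contrapT => H; apply: h => i Qi; apply: contrapT => ?; apply: H; exists i.
    by rewrite (bigD1 i)//= indicE memNset// mul0r.
  apply: eq_bigr => i Qi; rewrite expR_level_sum => [|a]; last exact: nest.
  by rewrite (sumc (fun k => \1_(level A i k) w)) /= indicT.
rewrite -expRD; have [|_] := boolP (w \in E); last exact: expR_ge0.
rewrite inE /E /= => h; rewrite -[leLHS]expR0 ler_expR; lra.
Qed.

Lemma natr_le_expr (h : R) n : 0 < h -> n%:R * h <= (1 + h) ^+ n.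
Proof.
move=> h0; suff : 1 + n%:R * h <= (1 + h) ^+ n by lra.
elim: n => [|n IH]; first by rewrite mul0r addr0 expr0.
rewrite exprS -natr1.
have h1 : 0 <= 1 + h by lra.
have := ler_wpM2l h1 IH; have : 0 <= n%:R * (h * h) by rewrite !mulr_ge0// ltW.
lra.
Qed.

(** Absorbs the factor [n^2] of a union bound over pairs of vertices: [n h <= (1 + h)^n], and [h] is
    small enough for [k (1 + h)^2 < 1]. *)
Lemma sqr_geometric_bound (k : R) : 0 <= k < 1 ->
  exists C k', [/\ 0 <= C, 0 <= k' < 1 & forall n, n%:R ^+ 2 * k ^+ n <= C * k' ^+ n].
Proof.
move=> /andP[k0 k1].
pose h := (1 - k) / 4; have h0 : 0 < h by rewrite divr_gt0// subr_gt0.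
exists (h ^- 2), (k * (1 + h) ^+ 2); split.
- by rewrite invr_ge0 sqr_ge0.
- rewrite mulr_ge0 ?sqr_ge0//= /h expr2; nra.
- move=> n; rewrite ler_pdivlMl ?exprn_gt0// mulrA mulrC [leRHS]exprMn.
  rewrite ler_wpM2l ?exprn_ge0// -exprMn -exprM mulnC exprM.
  rewrite ler_sqr ?nnegrE; first by rewrite mulrC natr_le_expr.
    by rewrite mulr_ge0// ltW.
  by rewrite exprn_ge0// addr_ge0// ltW.
Qed.

Lemma borel_cantelli_exponential (E : nat -> set Omega) (C k : R) N : 0 <= k < 1 ->
  (forall n, measurable (E n)) ->
  (forall n, (N <= n)%N -> (P (E n) <= (C * n%:R ^+ 2 * k ^+ n)%:E)%E) ->
  {ae P, forall w, \forall n \near \oo, ~ E n w}.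
Proof.
move=> k01 mE PE.
have [C' [k' [C'0 /andP[k'0 k'1] hk]]] := sqr_geometric_bound k01.
(* Emptying the events before rank [N] makes the bound valid for every [n] without changing the
   conclusion. *)
pose F n := if (N <= n)%N then E n else set0.
have mF n : measurable (F n) by rewrite /F; case: ifP.
pose D := `|C| * C'; have D0 : 0 <= D by rewrite mulr_ge0.
have PF n : (P (F n) <= (D * k' ^+ n)%:E)%E.
  rewrite /F; case: ifP => Nn; last by rewrite measure0 lee_fin mulr_ge0 ?exprn_ge0.
  apply: le_trans (PE n Nn) _; rewrite lee_fin -mulrA /D -(mulrA `|C|).
  apply: (@le_trans _ _ (`|C| * (n%:R ^+ 2 * k ^+ n))).
    rewrite ler_wpM2r ?ler_norm// mulr_ge0 ?exprn_ge0//.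
    by case/andP : k01.
  by rewrite ler_wpM2l.
have P0 : P (lim_sup_set F) = 0%E.
  apply: lim_sup_set_cvg0 => //.
  apply: (@le_lt_trans _ _ (D / (1 - k'))%:E); last exact: ltry.
  apply: lime_le; first by apply: is_cvg_nneseries.
  apply: nearW => n.
  apply: (@le_trans _ _ (\sum_(0 <= i < n) (D * k' ^+ i)%:E)%E).
    by apply: lee_sum => i _; exact: PF.
  rewrite sumEFin lee_fin -mulr_sumr ler_wpM2l//.
  rewrite -[leRHS]mul1r ler_pdivlMr ?subr_gt0// mulrC -opprB mulNr.
  rewrite big_mkord -subrX1 opprB lerBlDr lerDl exprn_ge0//.
exists (lim_sup_set F); split=> //.
  by apply: bigcap_measurable => // n _; exact: bigcup_measurable.
move=> w /= nw n _; apply: contrapT => H; apply: nw.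
exists (maxn n N) => // m /=; rewrite geq_max => /andP[nm Nm] Ew; apply: H.
by exists m => //; rewrite /F Nm.
Qed.

Lemma ae_forall_countable (T : countType) (Q : T -> Omega -> Prop) :
  (forall x, {ae P, forall w, Q x w}) -> {ae P, forall w, forall x, Q x w}.
Proof.
move=> H.
have : {ae P, forall w, forall n, if unpickle n is Some x then Q x w else True}.
  apply: ae_foralln => n; case: (unpickle n) => [x|]; first exact: H.
  exact: aeW.
apply: filterS => w h x; have := h (pickle x); by rewrite pickleK.
Qed.

End Concentration.

Lemma uniq_flatten_map (I T : eqType) (F : I -> seq T) (s : seq I) : uniq s ->
  (forall i, i \in s -> uniq (F i)) ->
  (forall i i' x, i \in s -> i' \in s -> x \in F i -> x \in F i' -> i = i') ->
  uniq (flatten (map F s)).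
Proof.
elim: s => //= i s IH /andP[ni us] hu hd.
rewrite cat_uniq hu ?mem_head//= IH//; last 2 first.
- by move=> j js; apply: hu; rewrite in_cons js orbT.
- by move=> j j' x js js'; apply: hd; rewrite in_cons ?js ?js' orbT.
rewrite andbT; apply/hasPn => x /flatten_mapP[j js xj].
apply/negP => /= xi; move: ni; rewrite (hd i j x) ?js//.
  exact: mem_head.
by rewrite in_cons js orbT.
Qed.

Lemma expr_size_flatten {R : realType} (I T : Type) (F : I -> seq T) (s : seq I) (c : R) :
  c ^+ size (flatten (map F s)) = \prod_(i <- s) c ^+ size (F i).
Proof.
by elim: s => [|i s IH]; rewrite ?big_nil ?expr0// big_cons -IH /= size_cat exprD.
Qed.

(** * Exponential rates for upper and lower tails *)

Section Rates.
Context {R : realType}.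

(** The mean of each variable is at most [c / (1 - q) < x]. The rate is uniform in the number [M] of
    levels, which will grow with [n]. *)
Lemma upper_rate (c q x : R) : 0 <= c -> 0 <= q < 1 -> c < x * (1 - q) ->
  exists theta k, [/\ 0 < theta, 0 <= k < 1 & forall M (f : nat -> R),
    (forall a, 0 <= f a <= c * q ^+ a) ->
    expR (- (theta * x)) *
      (1 + \sum_(a < M) (expR (theta * a.+1%:R) - expR (theta * a%:R)) * f a) <= k].
Proof.
move=> c0 /andP[q0 q1] cx.
have x0 : 0 < x.
  have q1' : 0 < 1 - q by lra.
  by rewrite -(pmulr_lgt0 _ q1'); exact: le_lt_trans cx.
have d0 : 0 <= c + x * q by rewrite addr_ge0// mulr_ge0// ltW.
(* [y] plays the role of [e^theta]. What is needed is [y > 1] and [y (c + x q) < x]; this is the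
   harmonic mean of the two bounds 1 and [x / (c + x q)]. *)
pose y := 2 * x / (x + (c + x * q)).
have y1 : 1 < y by rewrite /y ltr_pdivlMr; lra.
have hy : y * (c + x * q) < x.
  by rewrite /y mulrAC ltr_pdivrMr; [nra|lra].
have y0 : 0 < y by lra.
have yq : 0 < 1 - y * q by nra.
clearbody y.
pose theta := ln y; have ey : expR theta = y by rewrite lnK.
have theta0 : 0 < theta by rewrite ln_gt0.
pose b := 1 + (y - 1) * c / (1 - y * q).
exists theta, (expR (- (theta * x)) * b); split => //.
  have b0 : 0 <= b by rewrite addr_ge0// divr_ge0 ?mulr_ge0// ?ltW// subr_gt0.
  apply/andP; split; first by rewrite mulr_ge0// expR_ge0.
  rewrite expRN mulrC ltr_pdivrMr ?expR_gt0// mul1r.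
  apply: (@lt_le_trans _ _ (1 + theta * x)); last exact: expR_ge1Dx.
  rewrite /b ltrD2l ltr_pdivrMr//.
  have h1 : y - 1 <= theta * y.
    have := expR_ge1Dx (- theta); rewrite expRN ey => h.
    by move: h; rewrite -(ler_pM2r y0) mulVf ?gt_eqF//; lra.
  have h2 := ler_wpM2r c0 h1.
  have h3 : theta * (y * (c + x * q)) < theta * x by rewrite ltr_pM2l.
  lra.
move=> M f hf; rewrite ler_wpM2l ?expR_ge0// /b lerD2l.
have step a : (expR (theta * a.+1%:R) - expR (theta * a%:R)) * f a <=
    (y - 1) * c * (y * q) ^+ a.
  have -> : expR (theta * a.+1%:R) = y * y ^+ a.
    by rewrite mulrC expRM_natl ey exprS.
  rewrite (mulrC theta) expRM_natl ey exprMn.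
  have /andP[f0 f1] := hf a.
  have e0 : 0 <= (y - 1) * y ^+ a by rewrite mulr_ge0 ?exprn_ge0//; lra.
  have := ler_wpM2l e0 f1; lra.
apply: le_trans (ler_sum _ (fun a _ => step (val a))) _.
rewrite -mulr_sumr ler_wpM2l ?mulr_ge0//; first lra.
rewrite -[leRHS]mul1r ler_pdivlMr// mulrC -opprB mulNr -subrX1 opprB lerBlDr lerDl.
by rewrite exprn_ge0// mulr_ge0// ltW.
Qed.

Lemma telescope_ord (h : nat -> R) M : \sum_(a < M) (h a - h a.+1) = h 0 - h M.
Proof.
elim: M => [|M IH]; first by rewrite big_ord0 subrr.
by rewrite big_ord_recr /= IH; lra.
Qed.

Lemma lower_rate M (f0 : nat -> R) (x : R) : 0 <= x -> (forall a, 0 <= f0 a) ->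
  x < \sum_(a < M) f0 a ->
  exists theta k C, [/\ theta < 0, 0 <= k < 1, 0 <= C & forall (f : nat -> R) n m,
    (forall a, f0 a <= f a <= 1) -> (m <= n)%N -> (n <= m + 2)%N ->
    expR (- (theta * (x * n%:R))) *
      (1 + \sum_(a < M) (expR (theta * a.+1%:R) - expR (theta * a%:R)) * f a) ^+ m
    <= C * k ^+ n].
Proof.
move=> x0 f00; set y := \sum_(a < M) f0 a => xy.
have y0 : 0 < y by exact: le_lt_trans xy.
(* Chosen so that [D >= 1 - (1 - x / y) / 2 > x / y], that is [x < D y]; then
   [1 - tau D y < 1 - tau x <= e^(- tau x)]. *)
pose tau := (1 - x / y) / (2 * M.+1%:R).
have M0 : (0 : R) < M.+1%:R by rewrite ltr0n.
have xy1 : x / y < 1 by rewrite ltr_pdivrMr// mul1r.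
have tau0 : 0 < tau by rewrite divr_gt0 ?subr_gt0// mulr_gt0.
have tauE : tau * M.+1%:R = (1 - x / y) / 2.
  by rewrite /tau invfM mulrA -mulrA mulVf ?gt_eqF// mulr1.
pose D := expR (- (tau * M.+1%:R)).
have D0 : 0 < D by exact: expR_gt0.
have xD : x < D * y.
  rewrite -ltr_pdivrMr//; apply: (@lt_le_trans _ _ (1 + - (tau * M.+1%:R))).
    by rewrite tauE; lra.
  exact: expR_ge1Dx.
pose B := 1 - tau * (D * y).
have Bx : Num.max 0 B < expR (- (tau * x)).
  rewrite gt_max expR_gt0 /=.
  apply: (@lt_le_trans _ _ (1 + - (tau * x))); last exact: expR_ge1Dx.
  by rewrite /B ltrD2l ltrN2 ltr_pM2l.
(* The third constant pays for the at most two factors missing when [m < n], each of which is at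
   least [e^(- tau M)]. The maximum with 0 keeps the rate nonnegative before any [f] is given. *)
exists (- tau), (expR (tau * x) * Num.max 0 B), (expR (tau * M%:R) ^+ 2); split.
- by rewrite oppr_lt0.
- apply/andP; split; first by rewrite mulr_ge0 ?expR_ge0// le_max lexx.
  by rewrite -ltr_pdivlMl ?expR_gt0// mulr1 -expRN.
- exact: sqr_ge0.
move=> f n m hf mn nm.
set base := 1 + _.
pose g (a : nat) : R := expR (- (tau * a%:R)) - expR (- (tau * a.+1%:R)).
have g0 a : 0 <= g a.
  by rewrite subr_ge0 ler_expR lerN2 ler_pM2l// ler_nat leqnSn.
have baseE : base = 1 - \sum_(a < M) g a * f a.
  rewrite /base; congr (_ + _); rewrite -sumrN; apply: eq_bigr => a _.
  by rewrite /g !mulNr; lra.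
have base_ge : expR (- (tau * M%:R)) <= base.
  have tel : \sum_(a < M) g a = 1 - expR (- (tau * M%:R)).
    rewrite (telescope_ord (fun a : nat => expR (- (tau * a%:R)))).
    by rewrite mulr0 oppr0 expR0.
  have : \sum_(a < M) g a * f a <= \sum_(a < M) g a.
    apply: ler_sum => a _; rewrite ler_piMr//.
    by case/andP : (hf a).
  by rewrite tel baseE; lra.
have base_gt0 : 0 < base by apply: lt_le_trans base_ge; exact: expR_gt0.
have base_le : base <= B.
  rewrite baseE /B lerD2l lerN2 /y !mulr_sumr; apply: ler_sum => a _.
  rewrite mulrA.
  have h1 : tau * D <= g a.
    have -> : g a = expR (- (tau * a.+1%:R)) * (expR tau - 1).
      by rewrite /g mulrBr mulr1 -expRD -natr1; congr (expR _ - _); lra.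
    have h2 : D <= expR (- (tau * a.+1%:R)).
      by rewrite ler_expR lerN2 ler_pM2l// ler_nat ltnS ltnW.
    have h3 : tau <= expR tau - 1 by have := expR_ge1Dx tau; lra.
    by rewrite mulrC; apply: ler_pM => //; exact: ltW.
  have /andP[h2 _] := hf a.
  by apply: ler_pM => //; rewrite mulr_ge0// ltW.
have -> : - (- tau * (x * n%:R)) = n%:R * (tau * x) by lra.
rewrite expRM_natl exprMn mulrCA ler_wpM2l ?exprn_ge0 ?expR_ge0//.
have -> : base ^+ m = base^-1 ^+ (n - m) * base ^+ n.
  by rewrite -{2}(subnK mn) exprD mulrA -exprMn mulVf ?gt_eqF// expr1n mul1r.
apply: ler_pM; rewrite ?exprn_ge0 ?invr_ge0 ?(ltW base_gt0)//.
  apply: (@le_trans _ _ (expR (tau * M%:R) ^+ (n - m))).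
    rewrite lerXn2r ?nnegrE ?expR_ge0 ?invr_ge0 ?(ltW base_gt0)//.
    by rewrite -[leRHS]invrK -expRN lef_pV2 ?posrE// expR_gt0.
  apply: ler_weXn2l; last by rewrite leq_subLR.
  by rewrite -[leLHS]expR0 ler_expR mulr_ge0// ltW.
rewrite lerXn2r ?nnegrE ?(ltW base_gt0)// ?le_max ?lexx// base_le orbT//.
Qed.

End Rates.

(** * Random graphs with geometric chips *)

Section Constants.
Context {R : realType}.

(** The left side divided by [1 - e^(-b1)] is [expo_branch b1] at the right end of a grid cell; it
    has to stay below the target map at the left end, with a factor [1 - delta] to spare. Replacing
    degrees by [p (1 - delta) n] turns the rate [b] into [(1 - delta) b], which must still exceed
    [b1]. *)
Lemma upper_constants (b b' : R) : 0 < b' < b ->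
  exists delta N b1, [/\ 0 < delta < 1, (0 < N)%N, b' < b1, b1 < (1 - delta) * b &
    forall i, (i < N)%N -> expR (- (b1 * (1 - i.+1%:R / N%:R))) <
      (1 - delta) * expo_branch b' (i%:R / N%:R) * (1 - expR (- b1))].
Proof.
move=> /andP[b'0 bb']; have b0 : 0 < b by exact: lt_trans bb'.
pose b1 := (b + b') / 2; have b1b : b1 < b by rewrite /b1; lra.
have b'b1 : b' < b1 by rewrite /b1; lra.
have b10 : 0 < b1 by exact: lt_trans b'b1.
clearbody b1.
pose s := 1 - expR (- b'); pose s1 := 1 - expR (- b1).
have s0 : 0 < s by rewrite subr_gt0 expR_lt1 oppr_lt0.
have ss1 : s < s1 by rewrite /s /s1 ltrD2l ltrN2 ltr_expR ltrN2.
have s10 : 0 < s1 by exact: lt_trans ss1.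
have q1 : s / s1 < 1 by rewrite ltr_pdivrMr ?mul1r.
(* The first term ensures [b1 < (1 - delta) b]. The second lets the gain [s / s1 < 1] cover the
   factor [1 - delta] and the factor [e^(-b' / N)] of one grid step, since [1 / N <= delta]. *)
pose delta := Num.min ((b - b1) / (2 * b)) ((1 - s / s1) / (2 * (1 + b'))).
have h1 : delta * (2 * b) <= b - b1.
  by rewrite -ler_pdivlMr ?mulr_gt0// ge_min lexx.
have h2 : delta * (2 * (1 + b')) <= 1 - s / s1.
  by rewrite -ler_pdivlMr ?mulr_gt0 ?addr_gt0// ge_min lexx orbT.
have delta0 : 0 < delta.
  by rewrite lt_min; apply/andP; split; rewrite divr_gt0//; lra.
clearbody delta.
have q0 : 0 < s / s1 by rewrite divr_gt0.
have db' : 0 < delta * b' by rewrite mulr_gt0.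
have db : 0 < delta * b by rewrite mulr_gt0.
pose N := (Num.truncn delta^-1).+1.
have N0 : (0 : R) < N%:R by rewrite ltr0n.
have Nd : N%:R^-1 <= delta by rewrite invf_ple ?posrE// ltW// truncnS_gt.
exists delta, N, b1; split=> //; [by apply/andP; split; lra|lra|].
move=> i iN; rewrite /expo_branch.
set y := i.+1%:R / N%:R; set h := N%:R^-1 in Nd.
have y1 : y <= 1 by rewrite /y ler_pdivrMr// mul1r ler_nat.
have h0 : 0 < h by rewrite invr_gt0.
have -> : i%:R / N%:R = y - h by rewrite /y /h -natr1 mulrDl mul1r addrK.
have -> : b' * (y - h) = - (b' * (1 - y)) + (b' - b' * h) by lra.
rewrite expRD expRD.
have e0 := expRB1_gt0 b'0.
have -> : expR b' - 1 = expR b' * s by rewrite mulrBr mulr1 -expRD addrN expR0.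
set E := expR (- (b' * (1 - y))).
have E0 : 0 < E by exact: expR_gt0.
have EE : expR (- (b1 * (1 - y))) <= E.
  by rewrite ler_expR lerN2 ler_wpM2r ?subr_ge0// ltW.
have hh : 1 - b' * delta <= expR (- (b' * h)).
  apply: le_trans (expR_ge1Dx _); rewrite lerD2l lerN2 ler_pM2l//.
apply: le_lt_trans EE _.
have -> : E * (expR b' * expR (- (b' * h))) / (expR b' * s) =
    E * (expR (- (b' * h)) / s).
  by rewrite -mulrA; congr (_ * _); rewrite invfM mulrACA divff ?mul1r// gt_eqF ?expR_gt0.
set X := expR _ in hh *.
have -> : (1 - delta) * (E * (X / s)) * (1 - expR (- b1)) =
    E * ((1 - delta) * X * s1 / s) by rewrite -/s1; lra.
rewrite -[ltLHS]mulr1 ltr_pM2l// ltr_pdivlMr// mul1r.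
have d1 : 0 <= 1 - delta by lra.
have {}h2 : s <= s1 * (1 - 2 * delta - 2 * (delta * b')).
  rewrite -ler_pdivrMl// mulrC; lra.
apply: le_lt_trans h2 _; rewrite [ltRHS]mulrC ltr_pM2l//.
have := ler_wpM2l d1 hh; have : 0 <= delta * (delta * b') by rewrite mulr_ge0 ?ltW.
lra.
Qed.

Lemma sum_expR_geometric (b y : R) M : 0 < b ->
  (1 - expR (- b)) * \sum_(a < M) expR (- (b * (a.+1%:R - y))) =
  expR (- (b * (1 - y))) * (1 - expR (- b) ^+ M).
Proof.
move=> b0.
have -> : \sum_(a < M) expR (- (b * (a.+1%:R - y))) =
    expR (- (b * (1 - y))) * \sum_(a < M) expR (- b) ^+ a.
  rewrite mulr_sumr; apply: eq_bigr => a _.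
  by rewrite -expRM_natl -expRD -natr1; congr expR; lra.
rewrite mulrCA; congr (_ * _); rewrite -[RHS]opprB subrX1 -mulNr opprB.
by [].
Qed.

Lemma lower_constants (b b' : R) : 0 < b < b' ->
  exists delta N M b1, [/\ 0 < delta < 1, (0 < N)%N, 0 < b1, (1 + delta) * b < b1 &
    forall i, (i < N)%N -> (1 + delta) * expo_branch b' (i.+1%:R / N%:R) <
      (1 - delta) * \sum_(a < M) expR (- (b1 * (a.+1%:R - i%:R / N%:R)))].
Proof.
move=> /andP[b0 bb']; have b'0 : 0 < b' by exact: lt_trans bb'.
pose b1 := (b + b') / 2; have bb1 : b < b1 by rewrite /b1; lra.
have b1b' : b1 < b' by rewrite /b1; lra.
have b10 : 0 < b1 by exact: lt_trans bb1.
clearbody b1.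
pose s := 1 - expR (- b'); pose s1 := 1 - expR (- b1).
have s10 : 0 < s1 by rewrite subr_gt0 expR_lt1 oppr_lt0.
have s1s : s1 < s by rewrite /s /s1 ltrD2l ltrN2 ltr_expR ltrN2.
have s0 : 0 < s by exact: lt_trans s1s.
have q1 : s1 / s < 1 by rewrite ltr_pdivrMr ?mul1r.
have q0 : 0 < s1 / s by rewrite divr_gt0.
pose delta := Num.min ((b1 - b) / (2 * b)) ((1 - s1 / s) / (2 * (3 + b'))).
have h1 : delta * (2 * b) <= b1 - b.
  by rewrite -ler_pdivlMr ?mulr_gt0// ge_min lexx.
have h2 : delta * (2 * (3 + b')) <= 1 - s1 / s.
  by rewrite -ler_pdivlMr ?mulr_gt0 ?addr_gt0// ge_min lexx orbT.
have delta0 : 0 < delta.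
  by rewrite lt_min; apply/andP; split; rewrite divr_gt0//; lra.
clearbody delta.
have db' : 0 < delta * b' by rewrite mulr_gt0.
have db : 0 < delta * b by rewrite mulr_gt0.
pose N := (Num.truncn delta^-1).+1.
have N0 : (0 : R) < N%:R by rewrite ltr0n.
have Nd : N%:R^-1 <= delta by rewrite invf_ple ?posrE// ltW// truncnS_gt.
(* A lower bound may ignore the levels from [M] on; their share of the geometric series is at most
   [delta]. *)
have [M qM] : exists M, expR (- b1) ^+ M <= delta.
  have c : expR (- b1) ^+ j @[j --> \oo] --> (0 : R).
    by apply: cvg_expr; rewrite ger0_norm ?expR_ge0// expR_lt1 oppr_lt0.
  move/cvgrPdist_le/(_ _ delta0) : c => [M _ /(_ M (leqnn _))] /=.
  rewrite sub0r normrN ger0_norm ?exprn_ge0 ?expR_ge0// => ?; by exists M.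
exists delta, N, M, b1; split=> //; [by apply/andP; split; lra|lra|].
move=> i iN; rewrite /expo_branch.
set y := i%:R / N%:R; set h := N%:R^-1 in Nd.
have h0 : 0 < h by rewrite invr_gt0.
have -> : i.+1%:R / N%:R = y + h by rewrite /y /h -natr1 mulrDl mul1r.
have y1 : y <= 1 by rewrite /y ler_pdivrMr// mul1r ler_nat ltnW.
have -> : b' * (y + h) = - (b' * (1 - y)) + (b' + b' * h) by lra.
rewrite expRD expRD.
have e0 := expRB1_gt0 b'0.
have -> : expR b' - 1 = expR b' * s by rewrite mulrBr mulr1 -expRD addrN expR0.
set E := expR (- (b' * (1 - y))).
have E0 : 0 < E by exact: expR_gt0.
have EE : E <= expR (- (b1 * (1 - y))).
  by rewrite ler_expR lerN2 ler_wpM2r ?subr_ge0// ltW.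
have hh : (1 - b' * delta) * expR (b' * h) <= 1.
  rewrite -ler_pdivlMr ?expR_gt0// mul1r -expRN; apply: le_trans (expR_ge1Dx _).
  by rewrite lerD2l lerN2 ler_pM2l.
set X := expR (b' * h) in hh *.
have X0 : 0 < X by exact: expR_gt0.
have -> : E * (expR b' * X) / (expR b' * s) = E * (X / s).
  by rewrite -mulrA; congr (_ * _); rewrite invfM mulrACA divff ?mul1r// gt_eqF ?expR_gt0.
rewrite -(ltr_pM2l s10) [ltRHS]mulrCA sum_expR_geometric//.
set T := expR (- b1) ^+ M in qM *.
apply: (@lt_le_trans _ _ ((1 - delta) * (E * (1 - T)))); last first.
  have h3 : 0 <= (1 - delta) * (1 - T) by rewrite mulr_ge0; lra.
  by have := ler_wpM2r h3 EE; lra.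
have -> : s1 * ((1 + delta) * (E * (X / s))) = E * ((1 + delta) * X * (s1 / s)) by lra.
have -> : (1 - delta) * (E * (1 - T)) = E * ((1 - delta) * (1 - T)) by lra.
rewrite ltr_pM2l//; set r := s1 / s in q1 q0 h2 *.
have d3 : 0 < 1 - b' * delta by lra.
rewrite -(ltr_pM2l d3).
have h4 : 0 < (1 + delta) * r by rewrite mulr_gt0//; lra.
have := ler_wpM2l (ltW h4) hh.
have h5 : (1 - delta) * (1 - delta) <= (1 - delta) * (1 - T) by rewrite ler_wpM2l; lra.
have := ler_wpM2l (ltW d3) h5.
have h6 : 0 < delta * (1 - r) by rewrite mulr_gt0//; lra.
have h7 : 0 <= delta * (delta * (1 - b' * delta)) by rewrite !mulr_ge0 ?ltW.
have h8 : 0 <= delta * (delta * b') by rewrite !mulr_ge0 ?ltW.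
lra.
Qed.

End Constants.

Lemma prode_const {R : realType} (I : eqType) (s : seq I) (f : I -> \bar R) (c : R) :
  (forall i, i \in s -> f i = c%:E) -> (\prod_(i <- s) f i)%E = (c ^+ size s)%:E.
Proof.
elim: s => [|x s IH] H; first by rewrite big_nil expr0.
rewrite big_cons /= H ?mem_head// IH ?exprS ?EFinM// => i si.
by apply: H; rewrite in_cons si orbT.
Qed.

(** * Independence and tail bounds in the random model *)

Section Model.
Context {R : realType} {d : measure_display} {Omega : measurableType d}
  (P : probability Omega R).

Lemma uniform_prob_gt (t : R) : 0 <= t <= 1 ->
  uniform_prob (@ltr01 R) `]t, 1]%classic = (1 - t)%:E.
Proof.
move=> /andP[t0 t1]; rewrite /uniform_prob integral_uniform_pdf.
have -> : `]t, 1]%classic `&` `[0, 1]%classic = `]t, 1]%classic.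
  apply/seteqP; split=> x; first by case.
  rewrite /= !in_itv /= => /andP[tx x1]; split; first by rewrite tx.
  by rewrite x1 andbT (le_trans t0)// ltW.
rewrite (eq_integral (fun=> 1%:E)); last first.
  move=> x; rewrite inE /= in_itv /= => /andP[tx x1].
  by rewrite /uniform_pdf x1 (le_trans t0 (ltW tx)) /= subr0 invr1.
rewrite integral_cst//= lebesgue_measure_itv /= lte_fin mul1e.
have [//|] := ltP t 1 => t1'; have -> : t = 1 by apply/eqP; rewrite eq_le t1 t1'.
by rewrite subrr.
Qed.

Lemma uniform_prob_unit : uniform_prob (@ltr01 R) `[0, 1]%classic = 1%E.
Proof. exact: integral_uniform_pdf1. Qed.

Variables (p : R) (G : forall n : nat, Omega -> rel 'I_n)
  (U : forall n : nat, 'I_n -> nat -> {RV P >-> R}).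
Arguments G : clear implicits.
Hypotheses (hp : 0 < p <= 1) (hG : forall n : nat, erdos_renyi P p (G n))
  (hU : forall (n : nat) (v : 'I_n) (k : nat), uniform01 (U v k))
  (hind : mutually_independent P (source_events G U)).

Lemma graph_sym n w : symmetric (G n w).
Proof. by case: (hG n) => /(_ w)[]. Qed.

Lemma graph_irr n w : irreflexive (G n w).
Proof. by case: (hG n) => /(_ w)[]. Qed.

Definition edges_event n (L : seq ('I_n * 'I_n)) : set Omega :=
  [set w | forall e, e \in L -> G n w e.1 e.2].

Lemma edges_event_prob n (L : seq ('I_n * 'I_n)) :
  uniq L -> all (fun e : 'I_n * 'I_n => (e.1 < e.2)%N) L ->
  measurable (edges_event L) /\ P (edges_event L) = (p ^+ size L)%:E.
Proof.
move=> uL aL; have [_ edge ind] := hG n.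
pose E := {ij : 'I_n * 'I_n | (ij.1 < ij.2)%N}.
pose s : seq E := pmap insub L.
have es : edges_event L =
    \bigcap_(i in [set` s]) [set w | G n w (val i).1 (val i).2].
  apply/seteqP; split=> w H.
    by move=> i /=; rewrite mem_pmap_sub => /H.
  move=> e eL; have eo := allP aL _ eL.
  by apply: (H (Sub e eo)); rewrite /= mem_pmap_sub.
split.
  rewrite es; apply: fin_bigcap_measurable => [|i _]; first exact: finite_seq.
  exact: (edge _ _ (valP i)).1.
rewrite es ind//; last exact: pmap_sub_uniq.
rewrite (@prode_const _ _ s _ p).
  by rewrite size_pmap_sub; move: aL; rewrite all_count => /eqP ->.
by move=> i _; exact: (edge _ _ (valP i)).2.
Qed.

Definition uniforms_event n (K : seq ('I_n * nat)) (t : R) : set Omega :=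
  [set w | forall x, x \in K -> U x.1 x.2 w \in `]t, 1]].

Lemma uniform_gt_prob n (v : 'I_n) k (t : R) : 0 <= t <= 1 ->
  P (U v k @^-1` `]t, 1]%classic) = (1 - t)%:E.
Proof. by move=> t01; rewrite -uniform_prob_gt// -(hU v k). Qed.

(** Two independence hypotheses combine: all the edges belong to the single source [inl n], where
    [erdos_renyi] gives their product rule, and [hind] separates this source from the uniform
    variables. *)
Lemma sources_prob n (L : seq ('I_n * 'I_n)) (K : seq ('I_n * nat)) (t : R) :
  uniq L -> all (fun e : 'I_n * 'I_n => (e.1 < e.2)%N) L -> uniq K -> 0 <= t <= 1 ->
  measurable (edges_event L `&` uniforms_event K t) /\
  P (edges_event L `&` uniforms_event K t) =
    (p ^+ size L * (1 - t) ^+ size K)%:E.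
Proof.
move=> uL aL uK t01; have [mL PL] := edges_event_prob uL aL.
pose idx (x : 'I_n * nat) : nat + {n : nat & ('I_n * nat)%type} :=
  inr (existT (fun n => ('I_n * nat)%type) n x).
have idx_inj : injective idx.
  by move=> x y [] /eqP; rewrite eq_Tagged => /eqP.
pose s := inl n :: map idx K.
pose A (i : nat + {n : nat & ('I_n * nat)%type}) : set Omega :=
  match i with
  | inl _ => edges_event L
  | inr (existT m (v, k)) => U v k @^-1` `]t, 1]%classic
  end.
have es : edges_event L `&` uniforms_event K t = \bigcap_(i in [set` s]) A i.
  apply/seteqP; split=> w.
    move=> [wL wK] i /=; rewrite in_cons => /predU1P[->//|/mapP[[v k] xK ->]].
    exact: wK xK.
  move=> H; split; first by apply: (H (inl n)); rewrite /= mem_head.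
  move=> [v k] xK; apply: (H (idx (v, k))).
  by rewrite /= in_cons map_f ?orbT.
split.
  rewrite es; apply: fin_bigcap_measurable => [|i]; first exact: finite_seq.
  rewrite /= in_cons => /predU1P[->//|/mapP[[v k] xK ->]] /=.
  by rewrite -[X in measurable X]setTI; exact: measurable_funPT.
rewrite es hind.
- rewrite big_cons /= PL big_map EFinM; congr (_ * _)%E.
  by apply: prode_const => -[v k] _; exact: uniform_gt_prob.
- rewrite /= map_inj_uniq// uK andbT.
  by apply/negP => /mapP[].
- move=> i; rewrite in_cons => /predU1P[->|/mapP[[v k] xK ->]] /=.
    by exists [set r : rel 'I_n | forall e, e \in L -> r e.1 e.2].
  by exists `]t, 1]%classic.
Qed.

Definition ordered_pair n (v w : 'I_n) := if (v < w)%N then (v, w) else (w, v).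

Lemma ordered_pair_lt n (v w : 'I_n) : v != w ->
  ((ordered_pair v w).1 < (ordered_pair v w).2)%N.
Proof.
by rewrite /ordered_pair; have [| |/val_inj ->] := ltngtP v w; rewrite ?eqxx.
Qed.

Lemma graph_ordered_pair n w (u v : 'I_n) :
  G n w (ordered_pair u v).1 (ordered_pair u v).2 = G n w u v.
Proof. by rewrite /ordered_pair; case: ifP => //= _; rewrite graph_sym. Qed.

Lemma ordered_pairP n (a b u v : 'I_n) : ordered_pair a b = ordered_pair u v ->
  (a = u /\ b = v) \/ (a = v /\ b = u).
Proof.
rewrite /ordered_pair; do 2 case: ifP => _; case=> -> ->; by [left|right].
Qed.

(* The case [u = v] counts chips on the neighbours of one vertex; [u != v] serves to
   find common neighbours. *)
Definition star_event n (u v : 'I_n) (j : nat -> nat) (t : R) (i : 'I_n) (a : nat) :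
    set Omega :=
  edges_event [:: ordered_pair u i; ordered_pair v i]
  `&` uniforms_event [seq (i, k) | k <- iota 0 (j a)] t.

Lemma star_eventP n (u v : 'I_n) j t i a w : star_event u v j t i a w <->
  [/\ G n w u i, G n w v i & forall k, (k < j a)%N -> U i k w \in `]t, 1]].
Proof.
split=> [[hL hK]|[ui vi hU']].
  split.
  - by rewrite -graph_ordered_pair; apply: hL; rewrite mem_head.
  - by rewrite -graph_ordered_pair; apply: hL; rewrite !inE eqxx orbT.
  - by move=> k kj; apply: (hK (i, k)); apply: map_f; rewrite mem_iota.
split=> [e|[i' k] /mapP[x + [-> ->]]].
  by rewrite !inE => /orP[] /eqP ->; rewrite graph_ordered_pair.
by rewrite mem_iota => xj; exact: hU'.
Qed.

Definition star_count n (u v : 'I_n) j t M w : R :=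
  \sum_(i | (i != u) && (i != v)) \sum_(a < M) \1_(star_event u v j t i a) w.

(** Stars at distinct [i] outside [u] and [v] use disjoint sets of edges and of uniform variables,
    hence the product rule. A negative [theta] makes [E] a lower tail event. *)
Lemma star_chernoff n (u v : 'I_n) j t M theta S :
  (forall a, j a <= j a.+1)%N -> 0 <= t <= 1 ->
  let E := [set w | theta * S <= theta * star_count u v j t M w] in
  measurable E /\
  (P E <= (expR (- (theta * S)) *
    (1 + \sum_(a < M) (expR (theta * a.+1%:R) - expR (theta * a%:R)) *
       (p ^+ (1 + (u != v)) * (1 - t) ^+ j a)) ^+
     #|[pred i | (i != u) && (i != v)]|)%:E)%E.
Proof.
move=> jS t01; pose Q (i : 'I_n) := (i != u) && (i != v).
(* The two edges coincide when [u = v], and must then be counted once. *)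
pose L (k : nat) (i : 'I_n) : seq ('I_n * 'I_n) :=
  if k is a.+1 then undup [:: ordered_pair u i; ordered_pair v i] else [::].
pose K (k : nat) (i : 'I_n) := if k is a.+1 then [seq (i, x) | x <- iota 0 (j a)] else [::].
have uL k i : uniq (L k i) by case: k => // k; exact: undup_uniq.
have uK k i : uniq (K k i).
  by case: k => // k; rewrite map_inj_uniq ?iota_uniq// => x y [].
have memL k i e : e \in L k i -> e = ordered_pair u i \/ e = ordered_pair v i.
  by case: k => // k; rewrite mem_undup !inE => /orP[] /eqP ->; [left|right].
have aL k i : Q i -> all (fun e : 'I_n * 'I_n => (e.1 < e.2)%N) (L k i).
  move=> /andP[iu iv]; apply/allP => e /memL[] ->; apply: ordered_pair_lt.
    by rewrite eq_sym.
  by rewrite eq_sym.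
have levelE k i : level (star_event u v j t) i k =
    edges_event (L k i) `&` uniforms_event (K k i) t.
  case: k => [|k]; first by apply/seteqP; split.
  apply: (congr1 (fun X => X `&` _)); apply/seteqP; split=> w h e.
    by rewrite mem_undup; exact: h.
  by move=> eL; apply: h; rewrite mem_undup.
have levelP k i : Q i -> measurable (level (star_event u v j t) i k) /\
    P (level (star_event u v j t) i k) =
      (p ^+ size (L k i) * (1 - t) ^+ size (K k i))%:E.
  move=> Qi; rewrite levelE; apply: sources_prob => //; exact: aL.
have sizeL i k : Q i -> size (L k.+1 i) = (1 + (u != v))%N.
  move=> /andP[iu iv]; rewrite /L /= inE.
  have -> : (ordered_pair u i == ordered_pair v i) = (u == v).
    apply/eqP/eqP => [/ordered_pairP[[]//|[ui _]]|->//].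
    by move: iu; rewrite ui eqxx.
  by case: (u == v).
have nest i a : Q i -> star_event u v j t i a.+1 `<=` star_event u v j t i a.
  move=> Qi w /star_eventP[ui vi h]; apply/star_eventP; split=> // k kj.
  by apply: h; exact: leq_trans kj (jS a).
have prod (f : 'I_n -> nat) :
    fine (P (\bigcap_(i in [set i | Q i]) level (star_event u v j t) i (f i))) =
    \prod_(i | Q i) fine (P (level (star_event u v j t) i (f i))).
  pose s := enum Q.
  have sQ i : i \in s -> Q i by rewrite mem_enum.
  have -> : \bigcap_(i in [set i | Q i]) level (star_event u v j t) i (f i) =
      edges_event (flatten [seq L (f i) i | i <- s])
      `&` uniforms_event (flatten [seq K (f i) i | i <- s]) t.
    apply/seteqP; split=> w.
      move=> h; split=> x /flatten_mapP[i /sQ Qi xi].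
        by have := h i Qi; rewrite levelE => -[+ _]; apply.
      by have := h i Qi; rewrite levelE => -[_ +]; apply.
    move=> [hL hK] i /= Qi; have si : i \in s by rewrite mem_enum.
    by rewrite levelE; split=> x xi; [apply: hL|apply: hK];
      apply/flatten_mapP; exists i.
  have us : uniq s by exact: enum_uniq.
  have ufL : uniq (flatten [seq L (f i) i | i <- s]).
    apply: uniq_flatten_map => // i i' x /sQ/andP[iu iv] /sQ/andP[iu' iv'].
    move=> /memL[] -> /memL[] /ordered_pairP[[]//|[a b]];
      by move: iu iv iu' iv'; rewrite ?a ?b ?eqxx.
  have afL : all (fun e : 'I_n * 'I_n => (e.1 < e.2)%N) (flatten [seq L (f i) i | i <- s]).
    apply/allP => x /flatten_mapP[i /sQ Qi xi].
    exact: (allP (aL (f i) i Qi)).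
  have ufK : uniq (flatten [seq K (f i) i | i <- s]).
    apply: uniq_flatten_map => // i i' x _ _.
    by case: (f i) => // a; case: (f i') => // a' /mapP[? _ ->] /mapP[? _ [->]].
  have [_ ->] := sources_prob ufL afL ufK t01.
  rewrite /= !expr_size_flatten -big_split /= /s big_enum /=.
  apply: eq_bigr => i Qi; by rewrite (levelP _ _ Qi).2.
have [mE PE] := @level_chernoff R d Omega P _ Q (star_event u v j t) M theta S
  (fun i a Qi => (levelP a.+1 i Qi).1) nest prod.
split; first exact: mE.
apply: le_trans PE _; rewrite lee_fin ler_wpM2l ?expR_ge0//.
rewrite -prodr_const le_eqVlt; apply/orP; left; apply/eqP.
apply: eq_bigr => i Qi; congr (_ + _); apply: eq_bigr => a _; congr (_ * _).
by rewrite (levelP a.+1 i Qi).2 /= sizeL// size_map size_iota.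
Qed.

Lemma card_pair_complement n (u v : 'I_n) :
  (#|[pred i | (i != u) && (i != v)]| <= n)%N /\
  (n <= #|[pred i | (i != u) && (i != v)]| + 2)%N.
Proof.
split; first by rewrite -[X in (_ <= X)%N](card_ord n) max_card.
have := cardC [pred i | (i != u) && (i != v)]; rewrite card_ord => e.
rewrite -[X in (X <= _)%N]e leq_add2l; apply: (@leq_trans #|pred2 u v|).
  by apply: subset_leq_card; apply/fintype.subsetP => i; rewrite !inE negb_and !negbK.
by rewrite card2; case: (_ != _).
Qed.

Lemma ae_star_count_lt (j : nat -> nat -> nat) (t : nat -> R) (M : nat -> nat)
    (c q x : R) N :
  (forall n a, j n a <= j n a.+1)%N -> (forall n, 0 <= t n <= 1) ->
  0 <= c -> 0 <= q < 1 -> c < x * (1 - q) ->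
  (forall n a, (N <= n)%N -> p * (1 - t n) ^+ j n a <= c * q ^+ a) ->
  {ae P, forall w, \forall n \near \oo, forall v : 'I_n,
    star_count v v (j n) (t n) (M n) w < x * n%:R}.
Proof.
move=> jS t01 c0 q01 cx hc.
have [theta [k [theta0 k01 rate]]] := upper_rate c0 q01 cx.
have /andP[p0 _] := hp.
pose E n (v : 'I_n) := [set w | theta * (x * n%:R) <=
  theta * star_count v v (j n) (t n) (M n) w].
have mE n v : measurable (@E n v) by apply: (star_chernoff _ _ _ _ _ _ _).1.
have PE n (v : 'I_n) : (N <= n)%N -> (P (E n v) <= (k ^+ n)%:E)%E.
  move=> Nn; have [_] := star_chernoff v v (M n) theta (x * n%:R) (jS n) (t01 n).
  move=> /le_trans; apply; rewrite lee_fin eqxx addn0 expr1.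
  set base := 1 + _.
  have f0 a : 0 <= p * (1 - t n) ^+ j n a.
    by rewrite mulr_ge0 ?(ltW p0)// exprn_ge0// subr_ge0; case/andP : (t01 n).
  have base1 : 1 <= base.
    rewrite lerDl sumr_ge0// => a _; rewrite mulr_ge0// subr_ge0 ler_expR.
    by rewrite ler_pM2l// ler_nat.
  have [cn _] := card_pair_complement v v.
  apply: (@le_trans _ _ ((expR (- (theta * x)) * base) ^+ n)).
    rewrite exprMn -expRM_natl; apply: ler_pM; rewrite ?expR_ge0 ?exprn_ge0//.
    - by rewrite (le_trans _ base1).
    - by rewrite ler_expR; lra.
    - exact: ler_weXn2l.
  rewrite lerXn2r ?nnegrE//; last 1 first.
  - apply: (rate (M n) (fun a => p * (1 - t n) ^+ j n a)) => a; rewrite f0 /=; exact: hc.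
  - by rewrite mulr_ge0 ?expR_ge0// (le_trans _ base1).
  - by case/andP : k01.
have mU n : measurable [set w | exists v, E n v w].
  have -> : [set w | exists v, E n v w] = \bigcup_(v in [set: 'I_n]) E n v.
    by apply/seteqP; split=> w [v]; [move=> ?; exists v|move=> _ ?; exists v].
  by apply: fin_bigcup_measurable => //; exact: finite_finset.
(* The union over vertices gives [n k^n], which is at most [n^2 k^n] for [n >= 1]; hence the rank
   [N.+1]. *)
apply: filterS (borel_cantelli_exponential (E := fun n => [set w | exists v, E n v w])
    (C := 1) (k := k) (N := N.+1) k01 mU _).
  move=> w; apply: filterS => n H v; rewrite ltNge; apply/negP => h.
  by apply: H; exists v; rewrite /E /= ler_pM2l.
move=> n Nn.
have [_ /le_trans] := probability_union_le (mE n) (fun v => PE n v (ltnW Nn)).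
apply; rewrite lee_fin card_ord mul1r ler_wpM2r ?exprn_ge0//.
  by case/andP : k01.
rewrite expr2 ler_peMl// ler1n; exact: leq_trans Nn.
Qed.

(** The boolean selects the pairs with [u = v] or those with [u != v]; the other pairs get the empty
    event, so that one union bound over all pairs serves both. *)
Lemma ae_star_count_gt (b : bool) (j : nat -> nat -> nat) (t : nat -> R) M
    (f0 : nat -> R) (x : R) N :
  (forall n a, j n a <= j n a.+1)%N -> (forall n, 0 <= t n <= 1) ->
  0 <= x -> (forall a, 0 <= f0 a) -> x < \sum_(a < M) f0 a ->
  (forall n a, (N <= n)%N -> f0 a <= p ^+ (1 + b) * (1 - t n) ^+ j n a) ->
  {ae P, forall w, \forall n \near \oo, forall u v : 'I_n, (u != v) = b ->
    x * n%:R < star_count u v (j n) (t n) M w}.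
Proof.
move=> jS t01 x0 f00 xf hf.
have [theta [k [C [theta0 k01 C0 rate]]]] := lower_rate x0 f00 xf.
have /andP[p0 p1] := hp.
pose E n (e : 'I_n * 'I_n) := if (e.1 != e.2) == b then [set w | theta * (x * n%:R) <=
  theta * star_count e.1 e.2 (j n) (t n) M w] else set0.
have mE n e : measurable (@E n e).
  by rewrite /E; case: ifP => // _; apply: (star_chernoff _ _ _ _ _ _ _).1.
have /andP[k0 k1] := k01.
have PE n (e : 'I_n * 'I_n) : (N <= n)%N -> (P (E n e) <= (C * k ^+ n)%:E)%E.
  move=> Nn; rewrite /E; case: ifP => [/eqP eb|_]; last first.
    by rewrite measure0 lee_fin mulr_ge0// exprn_ge0.
  have [_] := star_chernoff e.1 e.2 M theta (x * n%:R) (jS n) (t01 n).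
  move=> /le_trans; apply; rewrite lee_fin eb.
  have [cn1 cn2] := card_pair_complement e.1 e.2.
  apply: (rate (fun a => p ^+ (1 + b) * (1 - t n) ^+ j n a)) => // a.
  have /andP[t0 t1] := t01 n.
  rewrite hf//= mulr_ile1 ?exprn_ge0 ?exprn_ile1 ?subr_ge0//; try exact: ltW; lra.
have mU n : measurable [set w | exists e, E n e w].
  have -> : [set w | exists e, E n e w] = \bigcup_(e in [set: 'I_n * 'I_n]) E n e.
    by apply/seteqP; split=> w [v]; [move=> ?; exists v|move=> _ ?; exists v].
  by apply: fin_bigcup_measurable => //; exact: finite_finset.
apply: filterS (borel_cantelli_exponential (E := fun n => [set w | exists e, E n e w])
    (C := C) (k := k) (N := N) k01 mU _).
  move=> w; apply: filterS => n H u v uv; rewrite ltNge; apply/negP => h.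
  by apply: H; exists (u, v); rewrite /E /= uv eqxx /= ler_nM2l.
move=> n Nn.
have [_ /le_trans] := probability_union_le (mE n) (fun e => PE n e Nn).
apply; rewrite lee_fin card_prod card_ord mulrA natrM expr2.
by rewrite (mulrC _ C).
Qed.

Definition good_uniforms (u : nat -> R) : Prop :=
  (forall k, u k \in `[0, 1]) /\ (forall e : R, 0 < e -> exists k, u k <= e).

Definition chips_threshold n (mu : R) : R := (1 + mu * n%:R)^-1.

Lemma chips_threshold_gt0 n mu : 0 <= mu -> 0 < chips_threshold n mu.
Proof. by move=> mu0; rewrite invr_gt0 ltr_pwDl// mulr_ge0. Qed.

Lemma chips_threshold_le1 n mu : 0 <= mu -> chips_threshold n mu <= 1.
Proof. by move=> mu0; rewrite invf_le1 ?ltr_pwDl ?lerDl ?mulr_ge0. Qed.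

Lemma geometric_chips_uniforms n mu (u : nat -> R) k :
  (k < geometric_chips n mu u)%N -> u k \in `]chips_threshold n mu, 1].
Proof. by rewrite /geometric_chips; case: xgetP => [x _ [+ _]|//]; apply. Qed.

Lemma uniforms_geometric_chips n mu (u : nat -> R) j : good_uniforms u -> 0 <= mu ->
  (forall k, (k < j)%N -> u k \in `]chips_threshold n mu, 1]) ->
  (j <= geometric_chips n mu u)%N.
Proof.
move=> [u01 usmall] mu0 uj; rewrite leqNgt; apply/negP => lt.
have [k0 uk0] := usmall _ (chips_threshold_gt0 n mu0).
have ex : exists k, u k <= chips_threshold n mu by exists k0.
move: lt; rewrite /geometric_chips; case: xgetP => [x _ [_ ux] xj|none _].
  move: (uj _ xj) ux; rewrite !in_itv /= => /andP[h _] /andP[_].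
  by rewrite leNgt => /negP; apply.
case: (ex_minnP ex) => k uk kmin; apply: (none k); split=> [i ik|].
  have := u01 i; rewrite !in_itv /= => /andP[_ ->]; rewrite andbT ltNge.
  by apply/negP => /kmin; rewrite leqNgt ik.
by have := u01 k; rewrite !in_itv /= => /andP[-> _].
Qed.

Lemma leq_geometric_chips n mu (u : nat -> R) j : good_uniforms u -> 0 <= mu ->
  (j <= geometric_chips n mu u)%N <->
  (forall k, (k < j)%N -> u k \in `]chips_threshold n mu, 1]).
Proof.
move=> gu mu0; split=> [jle k kj|]; last exact: uniforms_geometric_chips.
by apply: geometric_chips_uniforms; exact: leq_trans kj jle.
Qed.

Lemma geometric_chips_homo n mu mu' (u : nat -> R) : good_uniforms u -> 0 <= mu ->
  mu <= mu' -> (geometric_chips n mu u <= geometric_chips n mu' u)%N.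
Proof.
move=> gu mu0 le; have mu'0 : 0 <= mu' by exact: le_trans le.
apply: uniforms_geometric_chips => // k /geometric_chips_uniforms.
rewrite !in_itv /= => /andP[h ->]; rewrite andbT; apply: le_lt_trans h.
by rewrite lef_pV2 ?posrE ?ltr_pwDl ?mulr_ge0// lerD2l ler_wpM2r.
Qed.

Lemma ae_uniform_unit n (v : 'I_n) k : {ae P, forall w, U v k w \in `[0, 1]}.
Proof.
have m01 : measurable (U v k @^-1` `[0, 1]%classic).
  by rewrite -[X in measurable X]setTI; exact: measurable_funPT.
exists (~` (U v k @^-1` `[0, 1]%classic)); split.
- exact: measurableC.
- rewrite probability_setC//.
  have -> : P (U v k @^-1` `[0, 1]%classic) = 1%E.
    by rewrite -uniform_prob_unit -(hU v k).
  by rewrite subee.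
- by move=> w /= h h'; apply: h.
Qed.

Lemma ae_uniform_small n (v : 'I_n) (e : R) : 0 < e <= 1 ->
  {ae P, forall w, exists k, U v k w \notin `]e, 1]}.
Proof.
move=> /andP[e0 e1]; have e01 : 0 <= e <= 1 by rewrite ltW.
pose B j := edges_event ([::] : seq ('I_n * 'I_n))
  `&` uniforms_event [seq (v, k) | k <- iota 0 j] e.
have BP j : measurable (B j) /\ P (B j) = ((1 - e) ^+ j)%:E.
  have uK : uniq [seq (v, k) | k <- iota 0 j].
    by rewrite map_inj_uniq ?iota_uniq// => x y [].
  have [m] := sources_prob (L := [::]) isT isT uK e01.
  by rewrite expr0 mul1r size_map size_iota.
have mB : measurable (\bigcap_j B j) by apply: bigcapT_measurable => j; exact: (BP j).1.
exists (\bigcap_j B j); split=> //.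
  apply/eqP; rewrite eq_le measure_ge0 andbT.
  have le j : (P (\bigcap_j B j) <= ((1 - e) ^+ j)%:E)%E.
    rewrite -(BP j).2; apply: le_measure; rewrite ?inE//; first exact: (BP j).1.
    exact: bigcap_inf.
  have fP : P (\bigcap_j B j) \is a fin_num by rewrite fin_num_measure.
  rewrite -(fineK fP) lee_fin.
  have c : (1 - e) ^+ j @[j --> \oo] --> (0 : R).
    by apply: cvg_expr; rewrite ger0_norm; lra.
  apply: (cvgr_to_ge c); apply: nearW => j.
  by rewrite -lee_fin fineK.
move=> w /= H j _; split=> [//|[v' k] /mapP[x _ [-> ->]]].
by apply: contrapT => h; apply: H; exists x; apply/negP.
Qed.

Lemma ae_good_uniforms :
  {ae P, forall w, forall n (v : 'I_n), good_uniforms (fun k => U v k w)}.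
Proof.
have H n (v : 'I_n) : {ae P, forall w, good_uniforms (fun k => U v k w)}.
  have h1 : {ae P, forall w, forall k, U v k w \in `[0, 1]}.
    by apply: ae_foralln => k; exact: ae_uniform_unit.
  have h2 : {ae P, forall w, forall m, exists k, U v k w \notin `](m.+1%:R^-1), 1]}.
    apply: ae_foralln => m; apply: ae_uniform_small.
    by rewrite invr_gt0 ltr0n /= invf_le1 ?ler1n.
  apply: filterS2 h1 h2 => w g1 g2; split=> // e e0.
  have [k] := g2 (Num.truncn e^-1); have := g1 k.
  rewrite !in_itv /= => /andP[_ ->]; rewrite andbT -leNgt => h; exists k.
  apply: le_trans h _; rewrite invf_ple ?posrE//.
  by rewrite ltW// truncnS_gt.
apply: ae_foralln => n; apply: (ae_forall_countable (T := 'I_n)) => v; exact: H.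
Qed.

(** * Rounded chip counts summed over neighbours *)

Definition natceil (x : R) : nat := `|Num.ceil x|%N.

Lemma natceil_le (x : R) m : 0 <= x -> (natceil x <= m)%N = (x <= m%:R).
Proof.
move=> x0; have c0 : (0 <= Num.ceil x)%R by rewrite ceil_ge0 (lt_le_trans _ x0)// ltrN10.
rewrite pmulrn -ceil_le_int -lez_nat /natceil gez0_abs//.
Qed.

Lemma natceil_ge x : 0 <= x -> x <= (natceil x)%:R.
Proof. by move=> x0; rewrite -natceil_le. Qed.

Lemma natceil_leD1 x : 0 <= x -> (natceil x)%:R <= x + 1.
Proof.
move=> x0; apply: (@le_trans _ _ (Num.truncn x).+1%:R).
  by rewrite ler_nat natceil_le// ltW// truncnS_gt.
by rewrite -natr1 lerD2r truncn_le.
Qed.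

Lemma natceil_homo x y : 0 <= x -> x <= y -> (natceil x <= natceil y)%N.
Proof.
by move=> x0 xy; rewrite natceil_le// (le_trans xy)// natceil_ge// (le_trans x0).
Qed.

(** The least number of chips [X] for which the floor of [X / D + r] exceeds [a]. *)
Definition chip_level (r D : R) (a : nat) : nat := natceil ((a.+1%:R - r) * D).

Lemma chip_level_arg_ge0 (r D : R) a : r <= 1 -> 0 <= D -> 0 <= (a.+1%:R - r) * D.
Proof. by move=> r1 D0; rewrite mulr_ge0// subr_ge0 (le_trans r1)// ler1n. Qed.

Lemma chip_level_homo r D a : r <= 1 -> 0 <= D ->
  (chip_level r D a <= chip_level r D a.+1)%N.
Proof.
move=> r1 D0; apply: natceil_homo; first exact: chip_level_arg_ge0.
by rewrite ler_wpM2r// lerD2r ler_nat.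
Qed.

Lemma sum_ltn_minn M X : (\sum_(a < M) (a < X) = minn M X)%N.
Proof.
elim: M => [|M IH]; first by rewrite big_ord0 min0n.
rewrite big_ord_recr /= IH; case: (ltnP M X) => h.
  by rewrite addn1 (minn_idPl h).
by rewrite addn0 (minn_idPr (leqW h)).
Qed.

Definition chips n (mu : R) w : 'I_n -> R := chip_configuration mu (fun v k => U v k w).

Lemma star_count_chips n (v : 'I_n) mu r D M w :
  (forall v : 'I_n, good_uniforms (fun k => U v k w)) ->
  0 <= mu -> r <= 1 -> 0 < D ->
  star_count v v (chip_level r D) (chips_threshold n mu) M w =
  (\sum_(i | G n w v i) minn M (Num.truncn (chips mu w i / D + r)))%:R.
Proof.
move=> gU mu0 r1 D0; rewrite /star_count natr_sum big_mkcond [RHS]big_mkcond /=.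
apply: eq_bigr => i _; rewrite andbb; have [vi|nvi] := boolP (G n w v i); last first.
  case: ifP => // _; rewrite big1// => a _; rewrite indicE memNset//.
  by move=> /star_eventP[]; rewrite (negbTE nvi).
have -> : i != v by apply/eqP => iv; move: vi; rewrite iv graph_irr.
rewrite -sum_ltn_minn natr_sum; apply: eq_bigr => a _; rewrite indicE; congr (_ %:R).
congr nat_of_bool; rewrite truncn_gt_nat -lerBlDr ler_pdivlMr//.
rewrite -natceil_le; last by apply: chip_level_arg_ge0 => //; exact: ltW.
apply/idP/idP => [|h].
  by rewrite inE => /star_eventP[_ _] /(leq_geometric_chips _ _ (gU i) mu0).
rewrite inE; apply/star_eventP; split=> //.
exact/(leq_geometric_chips _ _ (gU i) mu0).
Qed.

Lemma star_count_edges n (u v : 'I_n) j t w : j 0 = 0%N ->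
  star_count u v j t 1 w = #|[pred i | G n w u i && G n w v i]|%:R.
Proof.
move=> j0; rewrite /star_count -sum1_card natr_sum big_mkcond [RHS]big_mkcond /=.
apply: eq_bigr => i _; rewrite big_ord1 inE /=.
have [uvi|nuvi] := boolP (G n w u i && G n w v i).
  have /andP[ui vi] := uvi.
  have -> : i != u by apply/eqP => iv; move: ui; rewrite iv graph_irr.
  have -> : i != v by apply/eqP => iv; move: vi; rewrite iv graph_irr.
  by rewrite indicE mem_set//; apply/star_eventP; split=> // k; rewrite j0.
case: ifP => // _; rewrite indicE memNset// => /star_eventP[ui vi _].
by move: nuvi; rewrite ui vi.
Qed.

Lemma star_count_degree n (v : 'I_n) j t w : j 0 = 0%N ->
  star_count v v j t 1 w = (degree (G n w) v)%:R.
Proof.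
move=> /star_count_edges ->; congr (_%:R); apply: eq_card => i.
by rewrite !inE andbb.
Qed.

Lemma ae_degree_lt (x : R) : p < x ->
  {ae P, forall w, \forall n \near \oo, forall v : 'I_n,
    (degree (G n w) v)%:R < x * n%:R}.
Proof.
move=> px; have /andP[p0 _] := hp.
(* Only level 0 is counted, and it asks for no uniform variable. With [t = 1] the higher levels have
   probability 0, so the geometric tail hypothesis holds with [q = 0]. *)
have H := @ae_star_count_lt (fun=> id) (fun=> 1) (fun=> 1%N) p 0 x 0.
apply: filterS (H _ _ (ltW p0) _ _ _) => //; last 4 first.
- by move=> n; rewrite ler01 lexx.
- by rewrite lexx ltr01.
- by rewrite subr0 mulr1.
- by move=> n a _; rewrite subrr.
move=> w; apply: filterS => n h v.
by rewrite -(@star_count_degree n v id 1 w erefl).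
Qed.

Lemma ae_degree_gt (x : R) : 0 <= x -> x < p ->
  {ae P, forall w, \forall n \near \oo, forall v : 'I_n,
    x * n%:R < (degree (G n w) v)%:R}.
Proof.
move=> x0 xp; have /andP[p0 _] := hp.
have H := @ae_star_count_gt false (fun _ _ => 0%N) (fun=> 0) 1 (fun=> p) x 0.
apply: filterS (H _ _ x0 _ _ _) => //.
- move=> w; apply: filterS => n h v.
  by rewrite -(@star_count_degree n v (fun=> 0%N) 0 w erefl) h// eqxx.
- by move=> n; rewrite lexx ler01.
- by move=> a; exact: ltW.
- by rewrite big_ord1.
- by move=> n a _; rewrite addn0 expr0 expr1 mulr1.
Qed.

Lemma ae_common_neighbours :
  {ae P, forall w, \forall n \near \oo, common_neighbours (G n w)}.
Proof.
have /andP[p0 _] := hp.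
have H := @ae_star_count_gt true (fun _ _ => 0%N) (fun=> 0) 1 (fun=> p ^+ 2) 0 0.
apply: filterS (H _ _ _ _ _ _) => //.
- move=> w; apply: filterS => n h u v uv; have := h u v uv.
  rewrite mul0r star_count_edges// ltr0n => /card_gt0P[x]; rewrite inE => ?.
  by exists x.
- by move=> n; rewrite lexx ler01.
- by move=> a; exact: sqr_ge0.
- by rewrite big_ord1 exprn_gt0.
- by move=> n a _; rewrite expr0 mulr1.
Qed.

Lemma ae_regular :
  {ae P, forall w, \forall n \near \oo,
    [/\ (0 < n)%N, common_neighbours (G n w) & no_isolated (G n w)]}.
Proof.
have /andP[p0 _] := hp.
apply: filterS2 ae_common_neighbours (ae_degree_gt (lexx 0) p0) => w h1 h2.
have pos : \forall n \near \oo, (0 < n)%N by exists 1%N.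
apply: filterS3 pos h1 h2 => n n0 cn dn; split=> // v.
by rewrite -(ltr0n R) -[ltLHS](mul0r n%:R).
Qed.

Lemma probability_gt_threshold n mu : 0 <= mu -> 0 <= chips_threshold n mu <= 1.
Proof. by move=> mu0; rewrite chips_threshold_le1// ltW// chips_threshold_gt0. Qed.

(** Capping at [M] is harmless in an upper bound: a capped term alone would already bring the sum to
    [M >= x]. *)
Lemma sum_minn_small (I : finType) (Q : pred I) (X : I -> nat) (M : nat) (x : R) :
  (\sum_(i | Q i) minn M (X i))%:R < x -> x <= M%:R -> (\sum_(i | Q i) X i)%:R < x.
Proof.
move=> h xM; suff -> : (\sum_(i | Q i) X i = \sum_(i | Q i) minn M (X i))%N by [].
apply: eq_bigr => i Qi; rewrite (minn_idPr _)// leqNgt; apply/negP => MX.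
have := lt_le_trans h xM; rewrite ltr_nat ltnNge => /negP; apply.
rewrite (bigD1 i)//= (minn_idPl (ltnW MX)); exact: leq_addr.
Qed.

Lemma ae_neighbour_chips_lt mu r delta b1 (x : R) : 0 < mu -> r <= 1 -> 0 < delta < 1 ->
  0 < b1 -> b1 < (1 - delta) * (p / mu) ->
  p * expR (- (b1 * (1 - r))) < x * (1 - expR (- b1)) ->
  {ae P, forall w, \forall n \near \oo, forall v : 'I_n,
    (\sum_(i | G n w v i)
      Num.truncn (chips mu w i / (p * (1 - delta) * n%:R) + r))%:R < x * n%:R}.
Proof.
move=> mu0 r1 /andP[delta0 delta1] b10 b1b xc; have /andP[p0 _] := hp.
have d1 : 0 < 1 - delta by lra.
pose D n := p * (1 - delta) * n%:R.
have D0 n : 0 <= D n by rewrite !mulr_ge0// ltW.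
pose M n := (Num.truncn (x * n%:R)).+1.
(* With [t = 1 / (1 + mu n)], the inequality [b1 <= t * D n] says that [n] times this gap is at
   least [b1], hence the rank [N]. *)
have gap : 0 < p * (1 - delta) - b1 * mu.
  have : b1 * mu < (1 - delta) * (p / mu) * mu by rewrite ltr_pM2r.
  by rewrite -mulrA divfK ?gt_eqF//; lra.
pose N := (Num.truncn (b1 / (p * (1 - delta) - b1 * mu))).+1.
have rate n a : (N <= n)%N ->
    p * (1 - chips_threshold n mu) ^+ chip_level r (D n) a <=
    p * expR (- (b1 * (1 - r))) * expR (- b1) ^+ a.
  move=> Nn; rewrite -mulrA ler_pM2l// -expRM_natl -expRD.
  set t := chips_threshold n mu.
  have t0 : 0 < t by apply: chips_threshold_gt0; exact: ltW.
  have t1 : t <= 1 by apply: chips_threshold_le1; exact: ltW.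
  apply: (@le_trans _ _ (expR (- t) ^+ chip_level r (D n) a)).
    rewrite lerXn2r ?nnegrE ?expR_ge0 ?subr_ge0//.
    exact: expR_ge1Dx.
  rewrite -expRM_natl ler_expR.
  have tD : b1 <= t * D n.
    rewrite mulrC /t /chips_threshold ler_pdivlMr; last first.
      by rewrite ltr_pwDl// mulr_ge0// ltW.
    have : b1 <= n%:R * (p * (1 - delta) - b1 * mu).
      rewrite -ler_pdivrMr//; apply: (@le_trans _ _ N%:R); last by rewrite ler_nat.
      by rewrite ltW// truncnS_gt.
    by rewrite /D; lra.
  have ar : 0 <= a.+1%:R - r by rewrite subr_ge0 (le_trans r1)// ler1n.
  have := ler_wpM2l ar tD.
  have := ler_wpM2l (ltW t0) (natceil_ge (chip_level_arg_ge0 a r1 (D0 n))).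
  rewrite -/(chip_level r (D n) a) -natr1; lra.
have H := @ae_star_count_lt (fun n => chip_level r (D n)) (fun n => chips_threshold n mu) M
  (p * expR (- (b1 * (1 - r)))) (expR (- b1)) x N.
have {}H := H (fun n a => chip_level_homo a r1 (D0 n))
  (fun n => probability_gt_threshold n (ltW mu0)) _ _ xc rate.
have c0 : 0 <= p * expR (- (b1 * (1 - r))) by rewrite mulr_ge0 ?expR_ge0// ltW.
have q01 : 0 <= expR (- b1) < 1 by rewrite expR_ge0 expR_lt1 oppr_lt0.
apply: filterS2 ae_good_uniforms (H c0 q01) => w gU h.
have pos : \forall n \near \oo, (0 < n)%N by exists 1%N.
apply: filterS2 pos h => n n0 h v.
apply: (@sum_minn_small _ _ _ (M n)); last by rewrite ltW// truncnS_gt.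
by rewrite -star_count_chips//; [exact: ltW|rewrite !mulr_gt0 ?ltr0n].
Qed.

Lemma ae_neighbour_chips_gt mu r delta b1 M (x : R) : 0 < mu -> r <= 1 ->
  0 < delta < 1 -> 0 < b1 -> (1 + delta) * (p / mu) < b1 -> 0 <= x ->
  x < p * (1 - delta) * \sum_(a < M) expR (- (b1 * (a.+1%:R - r))) ->
  {ae P, forall w, \forall n \near \oo, forall v : 'I_n,
    x * n%:R < (\sum_(i | G n w v i)
      Num.truncn (chips mu w i / (p * (1 + delta) * n%:R) + r))%:R}.
Proof.
move=> mu0 r1 /andP[delta0 delta1] b10 b1b x0 xc; have /andP[p0 _] := hp.
have d1 : 0 < 1 - delta by lra.
have d2 : 0 < 1 + delta by lra.
pose D n := p * (1 + delta) * n%:R.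
have D0 n : 0 <= D n by rewrite !mulr_ge0// ltW.
pose f0 (a : nat) := p * (1 - delta) * expR (- (b1 * (a.+1%:R - r))).
have f00 a : 0 <= f0 a by rewrite !mulr_ge0 ?expR_ge0// ltW.
have xf : x < \sum_(a < M) f0 a by rewrite -mulr_sumr.
(* Rounding a level up costs at most one more uniform variable, that is a factor [e^(-1 / (mu n))].
   From this rank on it is at least [1 - delta], the factor put into [f0]. *)
pose N := (Num.truncn (delta * mu)^-1).+1.
have rate n a : (N <= n)%N ->
    f0 a <= p ^+ (1 + false) * (1 - chips_threshold n mu) ^+ chip_level r (D n) a.
  move=> Nn; rewrite addn0 expr1 /f0 -mulrA ler_pM2l//.
  have n0 : (0 : R) < n%:R by rewrite ltr0n; exact: leq_trans Nn.
  have mn0 : 0 < mu * n%:R by rewrite mulr_gt0.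
  have s_ge : expR (- (mu * n%:R)^-1) <= 1 - chips_threshold n mu.
    rewrite expRN; have -> : 1 - chips_threshold n mu = (1 + (mu * n%:R)^-1)^-1.
      rewrite /chips_threshold; set z := mu * n%:R in mn0 *.
      have z1 : 0 < 1 + z by lra.
      have k1 : 0 < 1 + z^-1 by rewrite addr_gt0// invr_gt0.
      apply: (@mulIf _ (1 + z^-1)); first by rewrite gt_eqF.
      rewrite mulVf ?gt_eqF//.
      have e1 : (1 + z)^-1 * (1 + z) * z^-1 = z^-1 by rewrite mulVf ?mul1r ?gt_eqF.
      have e2 : (1 + z)^-1 * (z * z^-1) = (1 + z)^-1 by rewrite divff ?mulr1 ?gt_eqF.
      lra.
    rewrite lef_pV2 ?posrE ?expR_gt0//; last by rewrite addr_gt0// invr_gt0.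
    exact: expR_ge1Dx.
  apply: (@le_trans _ _ (expR (- (mu * n%:R)^-1) ^+ chip_level r (D n) a)); last first.
    rewrite lerXn2r ?nnegrE ?expR_ge0//; apply: le_trans s_ge; exact: expR_ge0.
  rewrite -expRM_natl.
  have small : (mu * n%:R)^-1 <= delta.
    rewrite invf_ple ?posrE//; have : (delta * mu)^-1 <= n%:R.
      by apply: (@le_trans _ _ N%:R); [rewrite ltW// truncnS_gt|rewrite ler_nat].
    by rewrite invfM ler_pdivrMr// mulrC (mulrC mu).
  apply: (@le_trans _ _ (expR (- delta) * expR (- (b1 * (a.+1%:R - r))))).
    by rewrite ler_wpM2r ?expR_ge0//; exact: expR_ge1Dx.
  rewrite -expRD ler_expR.
  have ar : 0 <= a.+1%:R - r by rewrite subr_ge0 (le_trans r1)// ler1n.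
  have i0 : 0 < (mu * n%:R)^-1 by rewrite invr_gt0.
  have := ler_wpM2r (ltW i0) (natceil_leD1 (chip_level_arg_ge0 a r1 (D0 n))).
  rewrite -/(chip_level r (D n) a) mulrDl mul1r.
  have -> : (a.+1%:R - r) * D n * (mu * n%:R)^-1 =
      (a.+1%:R - r) * ((1 + delta) * (p / mu)).
    rewrite /D invfM; have -> : (a.+1%:R - r) * (p * (1 + delta) * n%:R) * (mu^-1 * n%:R^-1) =
      (a.+1%:R - r) * ((1 + delta) * (p / mu)) * (n%:R / n%:R) by lra.
    by rewrite divff ?gt_eqF// mulr1.
  have := ler_wpM2l ar (ltW b1b).
  lra.
have H := @ae_star_count_gt false (fun n => chip_level r (D n))
  (fun n => chips_threshold n mu) M f0 x N
  (fun n a => chip_level_homo a r1 (D0 n))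
  (fun n => probability_gt_threshold n (ltW mu0)) x0 f00 xf rate.
apply: filterS2 ae_good_uniforms H => w gU h.
have pos : \forall n \near \oo, (0 < n)%N by exists 1%N.
apply: filterS2 pos h => n n0 h v.
apply: (@lt_le_trans _ _ (star_count v v (chip_level r (D n)) (chips_threshold n mu) M w)).
  by apply: h; rewrite eqxx.
rewrite star_count_chips//; [|exact: ltW|by rewrite !mulr_gt0 ?ltr0n].
by rewrite ler_nat; apply: leq_sum => i _; exact: geq_minr.
Qed.

(** * Almost sure bounds and convergence of the activity *)

Lemma ae_activity_le mu b' : 0 < mu -> 0 < b' < p / mu ->
  {ae P, forall w, \forall n \near \oo,
    activity (G n w) (chips mu w) <= expo_rotation b'}.
Proof.
move=> mu0 b'b; have /andP[p0 _] := hp; have /andP[b'0 _] := b'b.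
have [delta [N [b1 [d01 N0 b'b1 b1b H]]]] := upper_constants b'b.
have /andP[d0 d1] := d01.
have b10 : 0 < b1 by exact: lt_trans b'b1.
(* For [r] in the [i]-th cell, the sum of floors is bounded at the right end and the target map at
   the left end. The bound [p (1 - delta) n] on degrees is used twice: for the neighbours inside the
   floors, and for [v] on the other side. *)
pose x (i : 'I_N) := p * (1 - delta) * expo_branch b' (i%:R / N%:R).
have A : {ae P, forall w, forall i : 'I_N, \forall n \near \oo, forall v : 'I_n,
    (\sum_(k | G n w v k)
      Num.truncn (chips mu w k / (p * (1 - delta) * n%:R) + i.+1%:R / N%:R))%:R
    < x i * n%:R}.
  apply: (ae_forall_countable (T := 'I_N)) => i.
  apply: (ae_neighbour_chips_lt mu0 _ d01 b10 b1b).
    by rewrite ler_pdivrMr ?ltr0n// mul1r ler_nat.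
  by have := H i (ltn_ord i); rewrite -(ltr_pM2l p0) /x; lra.
have dx : p * (1 - delta) < p by rewrite gtr_pMr//; lra.
have dx0 : 0 < p * (1 - delta) by rewrite mulr_gt0//; lra.
apply: filterS3 A ae_regular (ae_degree_gt (ltW dx0) dx) => w /filter_forall A.
apply: filterS3 A => n A [n0 cn iso] deg.
have Dn0 : 0 < p * (1 - delta) * n%:R by rewrite mulr_gt0// ltr0n.
apply: (activity_le_rotation (Ordinal n0)) => //.
- exact: graph_sym.
- exact: expo_map_lift.
move=> v r /andP[r0 r1].
have rN0 : 0 <= r * N%:R by rewrite mulr_ge0.
have /andP[i1 i2] := truncn_itv rN0.
have NR0 : (0 : R) < N%:R by rewrite ltr0n.
have iN : (Num.truncn (r * N%:R) < N)%N by rewrite truncn_lt_nat// gtr_pMl.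
set i := Ordinal iN.
have ri : i%:R / N%:R <= r by rewrite ler_pdivrMr.
have ir : r <= i.+1%:R / N%:R by rewrite ler_pdivlMr// ltW.
rewrite expo_map_branch//; last by rewrite r0 ltW.
apply: (@le_trans _ _ (x i * n%:R)); last first.
  rewrite /x mulrAC; apply: ler_pM.
  - exact: ltW.
  - exact/ltW/expo_branch_gt0.
  - exact: ltW.
  - exact: expo_branch_le.
apply: ltW; apply: le_lt_trans (A i v).
rewrite ler_nat; apply: leq_sum => k _; apply: le_truncn; apply: lerD => //.
by rewrite ler_wpM2l// lef_pV2 ?posrE ?ltr0n// ltW.
Qed.

Lemma ae_activity_ge mu b' : 0 < mu -> p / mu < b' ->
  {ae P, forall w, \forall n \near \oo,
    expo_rotation b' <= activity (G n w) (chips mu w)}.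
Proof.
move=> mu0 bb'; have /andP[p0 _] := hp.
have b0 : 0 < p / mu by rewrite divr_gt0.
have b'0 : 0 < b' by exact: lt_trans bb'.
have b0b' : 0 < p / mu < b' by rewrite b0.
have [delta [N [M [b1 [d01 N0 b10 b1b H]]]]] := lower_constants b0b'.
have /andP[d0 d1] := d01.
pose x (i : 'I_N) := p * (1 + delta) * expo_branch b' (i.+1%:R / N%:R).
have dx : p < p * (1 + delta) by rewrite ltr_pMr//; lra.
have dx0 : 0 < p * (1 + delta) by exact: lt_trans dx.
have A : {ae P, forall w, forall i : 'I_N, \forall n \near \oo, forall v : 'I_n,
    x i * n%:R < (\sum_(k | G n w v k)
      Num.truncn (chips mu w k / (p * (1 + delta) * n%:R) + i%:R / N%:R))%:R}.
  apply: (ae_forall_countable (T := 'I_N)) => i.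
  apply: (ae_neighbour_chips_gt (M := M) mu0 _ d01 b10 b1b).
  - by rewrite ler_pdivrMr ?ltr0n// mul1r ler_nat ltnW.
  - by rewrite /x mulr_ge0 ?(ltW dx0)//; exact/ltW/expo_branch_gt0.
  - by have := H i (ltn_ord i); rewrite -(ltr_pM2l p0) /x; lra.
apply: filterS3 A ae_regular (ae_degree_lt dx) => w /filter_forall A.
apply: filterS3 A => n A [n0 cn iso] deg.
have Dn0 : 0 < p * (1 + delta) * n%:R by rewrite mulr_gt0// ltr0n.
apply: (activity_ge_rotation (Ordinal n0)) => //.
- exact: graph_sym.
- exact: expo_map_lift.
move=> v r /andP[r0 r1].
have rN0 : 0 <= r * N%:R by rewrite mulr_ge0.
have /andP[i1 i2] := truncn_itv rN0.
have NR0 : (0 : R) < N%:R by rewrite ltr0n.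
have iN : (Num.truncn (r * N%:R) < N)%N by rewrite truncn_lt_nat// gtr_pMl.
set i := Ordinal iN.
have ri : i%:R / N%:R <= r by rewrite ler_pdivrMr.
have ir : r <= i.+1%:R / N%:R by rewrite ler_pdivlMr// ltW.
rewrite expo_map_branch//; last by rewrite r0 ltW.
apply: (@le_trans _ _ (x i * n%:R)).
  rewrite /x mulrAC; apply: ler_pM => //.
  - exact/ltW/expo_branch_gt0.
  - exact: ltW.
  - exact: expo_branch_le.
apply: ltW; apply: lt_le_trans (A i v) _.
rewrite ler_nat; apply: leq_sum => k _; apply: le_truncn; apply: lerD => //.
by rewrite ler_wpM2l// lef_pV2 ?posrE ?ltr0n// ltW.
Qed.

Lemma chips_homo n mu mu' w (v : 'I_n) :
  (forall v : 'I_n, good_uniforms (fun k => U v k w)) -> 0 <= mu -> mu <= mu' ->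
  chips mu w v <= chips mu' w v.
Proof. by move=> gU mu0 le; rewrite ler_nat; exact: geometric_chips_homo. Qed.

(** A real [mu] is squeezed between rational parameters [m], and [p / m] is separated from a
    rational [b] whose rotation number is within [e] of the limit. *)
Lemma ae_activity_cvg : {ae P, forall w, forall mu : R, 0 <= mu ->
  activity (G n w) (@chips n mu w) @[n --> \oo] --> limit_activity p mu}.
Proof.
have /andP[p0 _] := hp.
have up : {ae P, forall w, forall mb : rat * rat, (0 : R) < ratr mb.1 ->
    (0 : R) < ratr mb.2 < p / ratr mb.1 -> \forall n \near \oo,
    activity (G n w) (chips (ratr mb.1) w) <= expo_rotation (ratr mb.2)}.
  apply: (ae_forall_countable (T := (rat * rat)%type)) => mb.
  have [h1|h1] := pselect (0 < ratr mb.1 :> R); last by apply: aeW.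
  have [h2|h2] := pselect ((0 : R) < ratr mb.2 < p / ratr mb.1); last by apply: aeW.
  by apply: filterS (ae_activity_le h1 h2).
have lo : {ae P, forall w, forall mb : rat * rat, (0 : R) < ratr mb.1 ->
    p / ratr mb.1 < ratr mb.2 -> \forall n \near \oo,
    expo_rotation (ratr mb.2) <= activity (G n w) (chips (ratr mb.1) w)}.
  apply: (ae_forall_countable (T := (rat * rat)%type)) => mb.
  have [h1|h1] := pselect (0 < ratr mb.1 :> R); last by apply: aeW.
  have [h2|h2] := pselect (p / ratr mb.1 < ratr mb.2); last by apply: aeW.
  by apply: filterS (ae_activity_ge h1 h2).
have base : {ae P, forall w,
    (forall n (v : 'I_n), good_uniforms (fun k => U v k w)) /\
    \forall n \near \oo,
      [/\ (0 < n)%N, common_neighbours (G n w) & no_isolated (G n w)]}.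
  by apply: filterS2 ae_good_uniforms ae_regular.
apply: filterS3 base up lo => w [gU reg] up lo mu mu0.
have chipsP n (m : R) (v : 'I_n) : 0 <= chips m w v by [].
apply/cvgrPdist_le => e e0.
have upper : \forall n \near \oo,
    activity (G n w) (@chips n mu w) <= limit_activity p mu + e.
  have [b [m [mum bm le]]] : exists b m : rat, [/\ mu < ratr m,
      (0 : R) < ratr b < p / ratr m & expo_rotation (ratr b) <= limit_activity p mu + e].
    (* At [mu = 0] there is no rate [p / mu] to approximate: any rational [b > 4] has rotation
       number 0, and [m] is any positive rational below [p / b]. *)
    move: mu0; rewrite le_eqVlt => /predU1P[<-|mu0].
      have [b] := @rat_in_itvoo R 4 5 ltac:(lra); rewrite in_itv /= => /andP[b4 _].
      have b0 : 0 < ratr b :> R by lra.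
      have pb : 0 < p / ratr b by rewrite divr_gt0.
      have [m] := rat_in_itvoo pb; rewrite in_itv /= => /andP[m0 mp].
      exists b, m; split=> //.
        by rewrite b0 ltr_pdivlMr// mulrC -ltr_pdivlMr.
      by rewrite expo_rotation_eq0 ?(ltW b4)// addr_ge0 ?limit_activity_ge0// ltW.
    have pmu : 0 < p / mu by rewrite divr_gt0.
    have [b0 /andP[b00 b0mu] le] := expo_rotation_left_approx pmu e0.
    have [b] := rat_in_itvoo b0mu; rewrite in_itv /= => /andP[bb0 bmu].
    have rb0 : 0 < ratr b :> R by exact: lt_trans bb0.
    have mub : mu < p / ratr b by rewrite ltr_pdivlMr// mulrC -ltr_pdivlMr.
    have [m] := rat_in_itvoo mub; rewrite in_itv /= => /andP[mum mb].
    have m0 : 0 < ratr m :> R by exact: lt_trans mum.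
    exists b, m; split=> //.
      by rewrite rb0 ltr_pdivlMr// mulrC -ltr_pdivlMr.
    rewrite (limit_activity_gt0 p mu0); apply: le_trans le.
    by apply: expo_rotation_antitone => //; exact: ltW.
  have m0 : 0 < ratr m :> R by exact: le_lt_trans mum.
  apply: filterS2 reg (up (m, b) m0 bm) => n [n0 cn iso] h.
  apply: le_trans le; apply: le_trans h.
  apply: (activity_le (Ordinal n0) (@graph_sym n w)) => // v.
  by apply: chips_homo => //; exact: ltW.
have lower : \forall n \near \oo,
    limit_activity p mu - e <= activity (G n w) (@chips n mu w).
  move: mu0; rewrite le_eqVlt => /predU1P[<-|mu0].
    apply: filterS reg => n [n0 cn iso].
    rewrite /limit_activity lexx; apply: (@le_trans _ _ 0); first lra.
    exact: (activity_ge0 (Ordinal n0) (@graph_sym n w)).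
  have pmu : 0 < p / mu by rewrite divr_gt0.
  have [b0 b0mu le] := expo_rotation_right_approx pmu e0.
  have [b] := rat_in_itvoo b0mu; rewrite in_itv /= => /andP[bmu bb0].
  have rb0 : 0 < ratr b :> R by exact: lt_trans bmu.
  have mub : p / ratr b < mu by rewrite ltr_pdivrMr// mulrC -ltr_pdivrMr.
  have [m] := rat_in_itvoo mub; rewrite in_itv /= => /andP[mb mum].
  have m0 : 0 < ratr m :> R by apply: lt_trans mb; rewrite divr_gt0.
  have mb' : p / ratr m < ratr b :> R by rewrite ltr_pdivrMr// mulrC -ltr_pdivrMr.
  apply: filterS2 reg (lo (m, b) m0 mb') => n [n0 cn iso] h.
  rewrite (limit_activity_gt0 p mu0); apply: le_trans le _.
  apply: (@le_trans _ _ (expo_rotation (ratr b))).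
    by apply: expo_rotation_antitone => //; exact: ltW.
  apply: le_trans h _.
  apply: (activity_le (Ordinal n0) (@graph_sym n w)) => // v.
  by apply: chips_homo => //; exact: ltW.
apply: filterS2 upper lower => n h1 h2.
by rewrite ler_norml; apply/andP; split; lra.
Qed.

End Model.

Theorem theorem6p9 (R : realType) (d : measure_display)
    (Omega : measurableType d) (P : probability Omega R) (p : R)
    (G : forall n : nat, Omega -> rel 'I_n)
    (U : forall n : nat, 'I_n -> nat -> {RV P >-> R})
    (hp : 0 < p <= 1)
    (hG : forall n : nat, erdos_renyi P p (G n))
    (hU : forall (n : nat) (v : 'I_n) (k : nat), uniform01 (U n v k))
    (hind : mutually_independent P (source_events G U)) :
  exists c : R -> R, devils_staircase 0 (p / ln 2) c /\
    {ae P, forall w : Omega, forall mu : R, mu \in `[0, p / ln 2] ->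
      activity (G n w) (chip_configuration mu (fun v k => U n v k w))
        @[n --> \oo] --> c mu}.
Proof.
have /andP[p0 _] := hp.
exists (limit_activity p); split; first exact: limit_activity_staircase.
apply: filterS (ae_activity_cvg hp hG hU hind) => w H mu.
by rewrite in_itv /= => /andP[mu0 _]; exact: H.
Qed.
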